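(* Let $\mathbf{w}\in\mathbb{R}^N$ satisfy $\mathbf{w}^T\mathbf{w}=1$ and $\gamma:=\mathbf{w}^T\mathbf{1}\ne 0$, and let $\rho>0$, where $\gamma$ and $\rho$ are constants independent of $h$ (and of the viscosity $\mu$). Let $$\mathcal{A}=\begin{bmatrix}A&-(B^\circ)^T\\-B^\circ&-\rho\,\mathbf{w}\mathbf{w}^T\end{bmatrix},\qquad \mathcal{P}_d=\begin{bmatrix}A&0\\0&\hat S\end{bmatrix},\qquad \hat S=\rho\,\mathbf{w}\mathbf{w}^T+M_p^\circ .$$ Then the residual of MINRES applied to the preconditioned system $\mathcal{P}_d^{-1}\mathcal{A}$ is bounded by $$\frac{\|\mathbf{r}_{2k}\|}{\|\mathbf{r}_0\|}\le 2\left(\frac{\sqrt d\,(1+\sqrt{1+4d})-2C_1}{\sqrt d\,(1+\sqrt{1+4d})+2C_1}+\mathcal{O}(h^d)\right)^k,$$ where $C_1=\beta^2\,\dfrac{\lambda_{\min}(M_p^\circ)}{\lambda_{\max}(M_p^\circ)}\,\gamma^2$.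
   Context: Let $\Omega\subset\mathbb{R}^d$ ($d=2,3$) be a bounded connected polygonal/polyhedral domain with Lipschitz boundary, and let $\mathcal{T}_h=\{K_1,\dots,K_N\}$ be a quasi-uniform simplicial mesh of $\Omega$ (from a quasi-uniform family) with maximum element diameter $h$; $|K|$ is the volume of $K$. Each element $K$ has facets $e_{K,1},\dots,e_{K,d+1}$ with $(d-1)$-dimensional measures $|e_{K,i}|$ and unit outward normals $\mathbf{n}_{K,i}$. Spaces. $\mathbf{V}_h^0$ is the set of pairs $\mathbf{v}=\{\mathbf{v}^\circ,\mathbf{v}^\partial\}$ where $\mathbf{v}^\circ$ is a constant vector in $\mathbb{R}^d$ on the interior of each element, $\mathbf{v}^\partial$ is a constant vector in $\mathbb{R}^d$ on each mesh facet (a single value per facet), and $\mathbf{v}^\partial=0$ on facets contained in $\partial\Omega$. $W_h$ is the space of functions that are constant on each element. Elements of $\mathbf{V}_h^0$ are identified with the vectors of their values on element interiors and interior facets, and elements of $W_h$ with vectors in $\mathbb{R}^N$ of their element values. Discrete weak operators. For a scalar component $u=\{u^\circ,u^\partial\}$, the weak gradient $\nabla_w u|_K\in RT_0(K)=P_0(K)^d+\mathbf{x}P_0(K)$ is defined by $(\nabla_w u,\mathbf{z})_K=(u^\partial,\mathbf{z}\cdot\mathbf{n})_{\partial K}-(u^\circ,\nabla\cdot\mathbf{z})_K$ for all $\mathbf{z}\in RT_0(K)$; for vector-valued $\mathbf{u}$, $\nabla_w\mathbf{u}$ is the matrix whose rows are the weak gradients of the components. The weak divergence $\nabla_w\cdot\mathbf{u}$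 is constant on each $K$ with $|K|\,(\nabla_w\cdot\mathbf{u})|_K=\sum_{i=1}^{d+1}|e_{K,i}|\,(\mathbf{u}^\partial|_{e_{K,i}})^T\mathbf{n}_{K,i}$. Matrices. $A$ and $B^\circ$ are defined by $\mathbf{v}^TA\mathbf{u}=\sum_{K}(\nabla_w\mathbf{u},\nabla_w\mathbf{v})_K$ and $\mathbf{q}^TB^\circ\mathbf{u}=\sum_K(\nabla_w\cdot\mathbf{u},q)_K$ for $\mathbf{u},\mathbf{v}\in\mathbf{V}_h^0$, $q\in W_h$. $A$ is symmetric positive definite. $M_p^\circ=\mathrm{diag}(|K_1|,\dots,|K_N|)$. $\mathbf{1}=\frac{1}{\sqrt N}(1,\dots,1)^T\in\mathbb{R}^N$; it spans the null space of $(B^\circ)^T$. $\lambda_{\min},\lambda_{\max}$ denote smallest and largest eigenvalues. (These matrices do not involve $\mu$; $\mathcal{A}$ is the coefficient matrix of the rescaled regularized Stokes system with unknowns $\mu\mathbf{u}_h$ and $\mathbf{p}_h$.) Inf-sup constant. $0<\beta<1$ is a constant independent of the mesh and of $\mu$ such that $\sup_{\mathbf{v}\in\mathbf{V}_h^0,\ \mathbf{v}\neq0}\frac{\mathbf{p}^TB^\circ\mathbf{v}}{(\mathbf{v}^TA\mathbf{v})^{1/2}}\ge\beta\,\|p\|_{L^2(\Omega)}$ for all $p\in W_h$ with $\int_\Omega p\,dx=0$ (such a $\beta$ is known to exist); here $\|p\|_{L^2(\Omega)}^2=\mathbf{p}^TM_p^\circ\mathbf{p}$. MINRES. For a linear system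 with matrix $\mathcal{A}$ and symmetric positive definite preconditioner $\mathcal{P}_d$, $\mathbf{r}_j$ denotes the $j$-th residual of MINRES applied to the symmetrically preconditioned matrix $\mathcal{P}_d^{-1/2}\mathcal{A}\mathcal{P}_d^{-1/2}$ (which is similar to $\mathcal{P}_d^{-1}\mathcal{A}$), so that in the Euclidean norm $\|\mathbf{r}_j\|=\min\{\|p(\mathcal{P}_d^{-1/2}\mathcal{A}\mathcal{P}_d^{-1/2})\mathbf{r}_0\|:\ p \text{ a polynomial of degree}\le j,\ p(0)=1\}$, with $\mathbf{r}_0\ne0$ the initial residual; $k\geq 0$ is an integer. $\mathcal{O}(h^d)$ denotes a quantity bounded in absolute value by a constant, independent of $h$, $\mu$ and $k$, times $h^d$ as $h\to0$. *)

(* Defs.v *)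
From HB Require Import structures.
From mathcomp Require Import all_boot all_order all_algebra.
From mathcomp Require Import all_classical all_reals all_analysis.

Set Implicit Arguments.
Unset Strict Implicit.
Unset Printing Implicit Defensive.

Import Order.TTheory GRing.Theory Num.Theory numFieldNormedType.Exports.

Local Open Scope classical_set_scope.
Local Open Scope ring_scope.

(* The space dimension is written d'.+1 throughout, since facets of simplices
   and local graphs of the boundary live in dimension d'. *)

Section LinearAlgebra.
Variable R : realType.

Definition dotr n (x y : 'rV[R]_n) : R := \sum_i x 0 i * y 0 i.

(* Euclidean norms; the library norm of a matrix is the maximum norm. *)
Definition enorm n (x : 'rV[R]_n) : R := Num.sqrt (dotr x x).
Definition cnorm n (x : 'cV[R]_n) : R := enorm x^T.

Definition spd n (M : 'M[R]_n) : Prop :=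
  M^T = M /\ forall v : 'cV[R]_n, v != 0 -> 0 < (v^T *m M *m v) 0 0.

(* H = P^(-1/2), the symmetric positive definite square root of P^-1. *)
Definition is_invsqrt n (P H : 'M[R]_n) : Prop :=
  spd H /\ H *m H = invmx P.

Definition lambda_min n (M : 'M[R]_n) : R := inf [set a | eigenvalue M a].
Definition lambda_max n (M : 'M[R]_n) : R := sup [set a | eigenvalue M a].

(* p(M) v; horner_mx is only available for sizes of the form n.+1. *)
Definition poly_mul n (M : 'M[R]_n) (p : {poly R}) (v : 'cV[R]_n) : 'cV[R]_n :=
  \sum_(i < size p) p`_i *: (M ^+ i *m v).

Definition minres_poly (j : nat) (p : {poly R}) : Prop :=
  (size p <= j.+1)%N /\ p.[0] = 1.

Definition minres_residual n (M : 'M[R]_n) (r0 : 'cV[R]_n) (j : nat)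
    (r : 'cV[R]_n) : Prop :=
  (exists2 p, minres_poly j p & r = poly_mul M p r0) /\
  forall p, minres_poly j p -> cnorm r <= cnorm (poly_mul M p r0).

End LinearAlgebra.

Section Domains.
Variables (R : realType) (d' : nat).
Local Notation d := d'.+1.
Implicit Type Omega : set 'rV[R]_d.

Definition boundary Omega : set 'rV[R]_d := closure Omega `\` interior Omega.

(* After a rigid motion, Omega is locally the strict epigraph of a Lipschitz
   function phi of the last d' coordinates. *)
Definition lipschitz_boundary Omega : Prop :=
  forall x, boundary Omega x ->
  exists (r L : R) (Q : 'M[R]_d) (phi : 'rV[R]_d' -> R),
    [/\ 0 < r, Q *m Q^T = 1%:M,
        forall a b, `|phi a - phi b| <= L * enorm (a - b) &
        forall y, enorm (y - x) < r ->
          let z : 'rV[R]_(1 + d') := (y - x) *m Q in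
          Omega y <-> phi (rsubmx z) < lsubmx z 0 0].

Definition polyhedral Omega : Prop :=
  exists s : seq ('rV[R]_d * R),
    (forall q, q \in s -> q.1 != 0) /\
    (forall x, boundary Omega x -> exists2 q, q \in s & dotr q.1 x = q.2).

Definition polyhedral_lipschitz_domain Omega : Prop :=
  [/\ Omega !=set0, open Omega, connected Omega & bounded_set Omega] /\
  polyhedral Omega /\ lipschitz_boundary Omega.

End Domains.

Section SimplexIntegral.
Variables (R : realType) (d' : nat).
Local Notation d := d'.+1.

(* Integral of f over { t in R^m | t_i >= 0, \sum_i t_i <= s }, as an iterated
   Lebesgue integral. *)
Fixpoint ref_simplex_int (m : nat) (s : R) : ('rV[R]_m -> R) -> R :=
  if m is m'.+1 then fun f : 'rV[R]_(1 + m') -> R =>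
    \int[lebesgue_measure]_(t in `[0, s])
      ref_simplex_int (s - t) (fun y : 'rV[R]_m' => f (row_mx t%:M y))
  else fun f => f 0.

Definition edge_mx m (p : 'I_m.+1 -> 'rV[R]_d) : 'M[R]_(m, d) :=
  \matrix_(i < m) (p (lift ord0 i) - p ord0).

(* Integral of f over the m-simplex with vertices p, with respect to
   m-dimensional surface measure: pull-back along the affine parametrization
   by the reference simplex, with the Gram determinant as area factor. For
   m = d the factor is the absolute value of the Jacobian determinant. *)
Definition simplex_int m (p : 'I_m.+1 -> 'rV[R]_d) (f : 'rV[R]_d -> R) : R :=
  let J := edge_mx p in
  Num.sqrt (\det (J *m J^T)) *
  ref_simplex_int 1 (fun t : 'rV[R]_m => f (p ord0 + t *m J)).

Definition simplex_measure m (p : 'I_m.+1 -> 'rV[R]_d) : R :=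
  simplex_int p (fun=> 1).

End SimplexIntegral.

(* Each element lists the indices of its d + 1 vertices. *)
Record mesh (R : realType) (d' : nat) := Mesh {
  nvert : nat;
  vert : 'I_nvert -> 'rV[R]_d'.+1;
  nelem : nat;
  elem : 'I_nelem -> 'I_d'.+2 -> 'I_nvert }.

Section Meshes.
Variables (R : realType) (d' : nat).
Local Notation d := d'.+1.
Implicit Types (T : mesh R d') (Omega : set 'rV[R]_d).

Definition vhull T (F : {set 'I_(nvert T)}) : set 'rV[R]_d :=
  [set x | exists l : 'I_(nvert T) -> R,
    [/\ forall v, 0 <= l v, forall v, v \notin F -> l v = 0,
        \sum_v l v = 1 & x = \sum_v l v *: vert v]].

Definition elem_vert T (K : 'I_(nelem T)) (i : 'I_d.+1) : 'rV[R]_d :=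
  vert (elem K i).

Definition elem_vset T (K : 'I_(nelem T)) : {set 'I_(nvert T)} :=
  [set elem K i | i : 'I_d.+1].

Definition elem_hull T (K : 'I_(nelem T)) : set 'rV[R]_d :=
  vhull (elem_vset K).

(* The facet e_{K,i} is the one opposite to the i-th vertex of K. *)
Definition facet T (K : 'I_(nelem T)) (i : 'I_d.+1) : {set 'I_(nvert T)} :=
  [set elem K (lift i j) | j : 'I_d].

Definition facet_vert T (K : 'I_(nelem T)) (i : 'I_d.+1) (j : 'I_d) :
  'rV[R]_d := elem_vert K (lift i j).

(* Conforming simplicial mesh of Omega. *)
Definition triangulates Omega T : Prop :=
  [/\ injective (@vert _ _ T),
      forall K : 'I_(nelem T), edge_mx (elem_vert K) \in unitmx,
      injective (@elem_vset T),
      closure Omega = \bigcup_(K in [set: 'I_(nelem T)]) elem_hull K &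
      forall K L : 'I_(nelem T),
        elem_hull K `&` elem_hull L = vhull (elem_vset K :&: elem_vset L)].

Definition elem_diam T (K : 'I_(nelem T)) : R :=
  sup [set r | exists x y,
    [/\ elem_hull K x, elem_hull K y & r = enorm (x - y)]].

Definition mesh_size T : R :=
  \big[Num.max/0]_(K < nelem T) elem_diam K.

(* Each element contains a ball of radius c * h, with the same c > 0 for all
   elements of all meshes of the family. *)
Definition quasi_uniform (F : set (mesh R d')) : Prop :=
  exists2 c : R, 0 < c &
    forall T, F T -> forall K : 'I_(nelem T),
      exists x, forall y, enorm (y - x) <= c * mesh_size T -> elem_hull K y.

Definition vol T (K : 'I_(nelem T)) : R := simplex_measure (elem_vert K).
Definition facet_area T (K : 'I_(nelem T)) (i : 'I_d.+1) : R :=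
  simplex_measure (facet_vert K i).

Definition is_outward_normal T (K : 'I_(nelem T)) (i : 'I_d.+1)
    (n : 'rV[R]_d) : Prop :=
  [/\ enorm n = 1,
      forall j k, dotr n (facet_vert K i j - facet_vert K i k) = 0 &
      forall j, dotr n (elem_vert K i - facet_vert K i j) < 0].

Definition normal T (K : 'I_(nelem T)) (i : 'I_d.+1) : 'rV[R]_d :=
  xget 0 [set n | is_outward_normal K i n].

End Meshes.

Section WeakGalerkin.
Variables (R : realType) (d' : nat).
Local Notation d := d'.+1.

Definition RT0 : set ('rV[R]_d -> 'rV[R]_d) :=
  [set z | exists (a : 'rV[R]_d) (b : R), z = fun x => a + b *: x].

Definition divergence (z : 'rV[R]_d -> 'rV[R]_d) (x : 'rV[R]_d) : R :=
  \sum_i 'D_(delta_mx 0 i) (fun y => z y 0 i : R) x.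

Section Spaces.
Variables (Omega : set 'rV[R]_d) (T : mesh R d').

Definition is_facet (F : {set 'I_(nvert T)}) : bool :=
  [exists K : 'I_(nelem T), exists i : 'I_d.+1, F == facet K i].

(* Facets not contained in the boundary of Omega. *)
Definition interior_facet (F : {set 'I_(nvert T)}) : bool :=
  is_facet F && ~~ `[< vhull F `<=` boundary Omega >].

(* An element of V_h^0 is the vector of the coordinates of its values on the
   element interiors and on the interior facets. *)
Definition dof : finType :=
  (('I_(nelem T) + {F : {set 'I_(nvert T)} | interior_facet F}) * 'I_d)%type.

Definition ndof : nat := #|dof|.

Implicit Types (u v : 'cV[R]_ndof) (K : 'I_(nelem T)).

Definition int_val u K : 'rV[R]_d :=
  \row_i u (enum_rank ((inl K, i) : dof)) 0.

Definition facet_val u (F : {set 'I_(nvert T)}) : 'rV[R]_d :=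
  \row_i if insub F is Some F' then u (enum_rank ((inr F', i) : dof)) 0 else 0.

(* Weak gradient on K of the scalar {a, b}. *)
Definition is_weak_grad K (a : R) (b : {set 'I_(nvert T)} -> R)
    (g : 'rV[R]_d -> 'rV[R]_d) : Prop :=
  RT0 g /\ forall z, RT0 z ->
    simplex_int (elem_vert K) (fun x => dotr (g x) (z x)) =
    \sum_i simplex_int (facet_vert K i)
             (fun x => b (facet K i) * dotr (z x) (normal K i))
    - simplex_int (elem_vert K) (fun x => a * divergence z x).

Definition weak_grad K a b : 'rV[R]_d -> 'rV[R]_d :=
  xget (fun=> 0) [set g | is_weak_grad K a b g].

Definition weak_grad_mx u K (x : 'rV[R]_d) : 'M[R]_d :=
  \matrix_(i < d)
    weak_grad K (int_val u K 0 i) (fun F => facet_val u F 0 i) x.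

Definition weak_div u K : R :=
  (vol K)^-1 *
  \sum_i facet_area K i * dotr (facet_val u (facet K i)) (normal K i).

Definition stiffness_matrix (A : 'M[R]_ndof) : Prop :=
  forall u v, (v^T *m A *m u) 0 0 =
    \sum_K simplex_int (elem_vert K) (fun x =>
      \sum_i \sum_j weak_grad_mx u K x i j * weak_grad_mx v K x i j).

Definition divergence_matrix (B : 'M[R]_(nelem T, ndof)) : Prop :=
  forall u (q : 'cV[R]_(nelem T)), (q^T *m B *m u) 0 0 =
    \sum_K simplex_int (elem_vert K) (fun=> weak_div u K * q K 0).

Definition pressure_mass : 'M[R]_(nelem T) := diag_mx (\row_K vol K).

(* The supremum is taken in the extended reals, as sup is 0 by convention on
   unbounded sets of reals. *)
Definition inf_sup (A : 'M[R]_ndof) (B : 'M[R]_(nelem T, ndof)) (beta : R) :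
    Prop :=
  forall p : 'cV[R]_(nelem T),
    \sum_K simplex_int (elem_vert K) (fun=> p K 0) = 0 ->
    ((beta * Num.sqrt ((p^T *m pressure_mass *m p) 0 0))%:E <=
     ereal_sup [set ((p^T *m B *m v) 0 0 / Num.sqrt ((v^T *m A *m v) 0 0))%R%:E |
                v in [set v : 'cV[R]_ndof | (v != 0)%R]])%E.

Definition stokes_matrix (A : 'M[R]_ndof) (B : 'M[R]_(nelem T, ndof))
    (rho : R) (w : 'cV[R]_(nelem T)) : 'M[R]_(ndof + nelem T) :=
  block_mx A (- B^T) (- B) (- (rho *: (w *m w^T))).

Definition schur_approx (rho : R) (w : 'cV[R]_(nelem T)) : 'M[R]_(nelem T) :=
  rho *: (w *m w^T) + pressure_mass.

Definition block_precond (A : 'M[R]_ndof) (rho : R) (w : 'cV[R]_(nelem T)) :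
    'M[R]_(ndof + nelem T) :=
  block_mx A 0 0 (schur_approx rho w).

End Spaces.

(* The vector 1 = (1, ..., 1)^T / sqrt N. *)
Definition unit_ones N : 'cV[R]_N := const_mx (Num.sqrt N%:R)^-1.

End WeakGalerkin.
Arguments unit_ones {R N}.

(* Main.v *)
Require Import Defs.
From mathcomp Require Import all_boot all_order all_algebra.
From mathcomp Require Import all_classical all_reals all_analysis.
From mathcomp Require Import perm complex ring lra.

Set Implicit Arguments.
Unset Strict Implicit.
Unset Printing Implicit Defensive.

Import Order.TTheory GRing.Theory Num.Theory numFieldNormedType.Exports.

Local Open Scope classical_set_scope.
Local Open Scope ring_scope.

(* The eigenvalues of P^(-1/2) A P^(-1/2) are those of the pencil (A, P).
   Testing the eigenvalue equation with the eigenvector (u, p), and using that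
   the squared norm of the weak divergence is at most d times the energy (the
   weak divergence being the mean trace of the weak gradient), one finds that
   they lie in [-(m - 1), -b] or in [1, m], where m = (1 + sqrt (1 + 4 d)) / 2
   satisfies m (m - 1) = d. The bound -b comes from the inf-sup condition for
   the mean-zero part of p, the constant part being controlled by w^T p: as soon
   as lambda_max(M_p) <= rho gamma^2 / 6, which holds for h small, one can take
   b = 2 C1 / (3 m).
   On this set the quadratic x^2 - (1 - b) x has values in [b, d + b m], so that
   its composition with a Chebyshev polynomial of degree k, suitably rescaled,
   is a MINRES polynomial of degree 2 k. The resulting rate is below the one of
   the theorem by a margin that absorbs the factor 2 / 3, hence E can be 0.

   That (1, ..., 1) is in the kernel of B^T amounts to the fact that an interior
   facet lies in exactly two elements, on opposite sides. *)

(** * Chebyshev bound for MINRES *)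

(** The factor 2 / 3 comes from Young's inequality (a + b)^2 <= 3 a^2 + 3 / 2 b^2, used to recover
    the constant part of p from w^T p and the mean-zero part; the 6 then keeps the total w-term
    within rho (w^T p)^2. For d = 2, where m = 2, and C1 = 1 the comparison of the two rates is an
    equality, so 2 / 3 cannot be lowered in this argument.

    No inverse of A and no Schur complement is formed: the first block row of the eigenvalue
    equation says that (1 - mu) u is the Riesz representative of B^T p in the energy product, and
    the inf-sup condition bounds its energy from below.

    On the geometric side, weak gradients and normals are picked by a choice operator, so a solution
    must be exhibited before their defining equations can be used. Iterated integrals are not
    additive without integrability; they are computed exactly on polynomials by Dirichlet's formula,
    and linearity is read off from it. The pairing of elements at an interior facet is extracted
    from the covering and intersection properties of the mesh, through the signs of barycentric
    coordinates. *)

Section Spectral.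
Variable R : realType.
Local Notation C := R[i].
Local Notation toC := (real_complex R).

Lemma unitary_sqnorm n (P : 'M[C]_n) (x : 'cV[C]_n) : P \is unitarymx ->
  \sum_i `|(P *m x) i 0| ^+ 2 = \sum_i `|x i 0| ^+ 2.
Proof.
have sqE (y : 'cV[C]_n) : \sum_i `|y i 0| ^+ 2 = ((map_mx Num.conj y^T) *m y) 0 0.
  by rewrite mxE; apply: eq_bigr => i _; rewrite !mxE normCKC.
move=> Pu; rewrite !sqE trmx_mul map_mxM -mulmxA [map_mx _ P^T *m _]mulmxA.
by rewrite -invmx_unitary // mulVmx ?mul1mx ?unitarymx_unit.
Qed.

Lemma diag_mx_exp n (D : 'rV[C]_n) k :
  diag_mx D ^+ k = diag_mx (\row_j D 0 j ^+ k).
Proof.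
elim: k => [|k IH].
  by apply/matrixP => i j; rewrite expr0 !mxE expr0.
rewrite exprS IH; apply/matrixP => i j; rewrite -[_ * _]/(_ *m _).
rewrite mul_diag_mx !mxE; case: eqP => [->|_]; last by rewrite !mulr0n mulr0.
by rewrite !mulr1n exprS.
Qed.

(** Over [R[i]] the matrix is Hermitian, hence unitarily diagonalizable; in that basis p(M) acts on
    the j-th coordinate as multiplication by p at the j-th eigenvalue, and the unitary change of
    basis preserves norms. *)
Lemma real_symmetric_poly_bound n (M : 'M[R]_n) (p : {poly R}) (c : R)
    (v : 'cV[R]_n) : M^T = M -> 0 <= c ->
  (forall a, eigenvalue M a -> `|p.[a]| <= c) ->
  cnorm (poly_mul M p v) <= c * cnorm v.
Proof.
move=> Msym c0 hp.
pose M' := map_mx toC M.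
have Mherm : M' \is hermsymmx.
  apply: realsym_hermsym.
    apply/is_hermitianmxP; rewrite expr0 scale1r map_mx_id // /M' -[LHS]trmxK.
    by congr trmx; rewrite map_trmx Msym.
  by apply/mxOverP => i j; rewrite mxE complex_real.
have /hermitian_normalmx/orthomx_spectralP := Mherm.
set P := spectralmx M'; set sp := spectral_diag M' => ME.
have Pu : P \is unitarymx by exact: spectral_unitarymx.
have Punit : P \in unitmx := unitarymx_unit Pu.
(* Hermitian matrices have real spectrum; comparing characteristic polynomials shows that each
   diagonal entry is an eigenvalue of the real matrix [M], where [hp] applies. *)
have spR j : exists a : R, sp 0 j = toC a /\ `|p.[a]| <= c.
  have /mxOverP/(_ 0 j) := hermitian_spectral_diag_real Mherm.
  move=> /complex_realP[a spE]; exists a; split; first exact: spE.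
  apply: hp; have : eigenvalue M' (sp 0 j).
    apply/eigenvalueP; exists (row j P).
      rewrite {1}ME !mulmxA -row_mul mulmxV // row1 -rowE.
      by rewrite row_diag_mx -scalemxAl -rowE.
    apply/eqP => /(congr1 (fun r => r *m invmx P)).
    rewrite -row_mul mulmxV // mul0mx => /rowP/(_ j).
    by rewrite !mxE eqxx => /eqP; rewrite oner_eq0.
  rewrite [sp 0 j]spE !eigenvalue_root_char -[a%:C%C]/(toC a) /M'.
  by rewrite -map_char_poly fmorph_root.
have polyE j : (P *m map_mx toC (poly_mul M p v)) j 0 =
    (map_poly toC p).[sp 0 j] * (P *m map_mx toC v) j 0.
  have expE k : map_mx toC (M ^+ k *m v) =
      invmx P *m (diag_mx (\row_j sp 0 j ^+ k) *m (P *m map_mx toC v)).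
    rewrite map_mxM -diag_mx_exp !mulmxA; congr (_ *m _).
    elim: k => [|k IH]; first by rewrite !expr0 map_mx1 mulmx1 mulVmx.
    rewrite !exprSr -[M ^+ k * M]/(_ *m _) -[diag_mx sp ^+ k * _]/(_ *m _).
    by rewrite map_mxM IH -/M' ME !mulmxA mulmxK.
  rewrite /poly_mul raddf_sum mulmx_sumr summxE horner_coef size_map_poly.
  rewrite mulr_suml; apply: eq_bigr => i _.
  rewrite /= map_mxZ expE -scalemxAr mulKVmx // mxE mul_diag_mx !mxE coef_map.
  by rewrite mulrA.
have nsq (x : 'cV[R]_n) : cnorm x ^+ 2 = \sum_i x i 0 ^+ 2.
  rewrite /cnorm /enorm /dotr sqr_sqrtr; first by apply: eq_bigr => i _; rewrite !mxE.
  by apply: sumr_ge0 => i _; rewrite -expr2 sqr_ge0.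
have nsqC (x : 'cV[R]_n) :
    toC (cnorm x ^+ 2) = \sum_i `|(P *m map_mx toC x) i 0| ^+ 2.
  rewrite unitary_sqnorm // nsq rmorph_sum; apply: eq_bigr => i _ /=.
  rewrite mxE normc_def /= expr0n addr0 sqrtr_sqr rmorphXn /=.
  by rewrite -!rmorphXn /= real_normK ?num_real.
rewrite -[leLHS]ger0_norm ?sqrtr_ge0 // -[leRHS]ger0_norm ?mulr_ge0 ?sqrtr_ge0 //.
rewrite -ler_sqr ?nnegrE ?normr_ge0 // !real_normK ?num_real //.
rewrite exprMn -lecR.
have -> : (c ^+ 2 * cnorm v ^+ 2)%:C%C = toC (c ^+ 2) * toC (cnorm v ^+ 2).
  exact: (rmorphM toC).
have -> : (cnorm (poly_mul M p v) ^+ 2)%:C%C =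
  toC (cnorm (poly_mul M p v) ^+ 2) by [].
rewrite !nsqC.
rewrite mulr_sumr; apply: ler_sum => j _; rewrite polyE normrM exprMn.
apply: ler_wpM2r; first by rewrite exprn_ge0.
have [a [-> pa]] := spR j; rewrite horner_map /= normc_def /= expr0n addr0 sqrtr_sqr.
rewrite -rmorphXn /= lecR ler_sqr ?nnegrE ?normr_ge0 //.
Qed.
End Spectral.

(** * Chebyshev polynomials and the two-interval convergence rate *)

Section Chebyshev.
Variable R : realType.

(* The pairs (T_n, U_(n-1)) of Chebyshev polynomials. *)
Fixpoint cheb (n : nat) : {poly R} * {poly R} :=
  if n is n'.+1 then
    let: (t, u) := cheb n' in ('X * t - (1 - 'X^2) * u, 'X * u + t)
  else (1, 0).

Lemma chebS n : cheb n.+1 =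
  ('X * (cheb n).1 - (1 - 'X^2) * (cheb n).2, 'X * (cheb n).2 + (cheb n).1).
Proof. by rewrite /=; case: (cheb n). Qed.

Lemma size_cheb n : (size (cheb n).1 <= n.+1)%N /\ (size (cheb n).2 <= n)%N.
Proof.
elim: n => [|n [IH1 IH2]]; first by rewrite /= size_poly1 size_poly0.
have sX (p : {poly R}) m : (size p <= m)%N -> (size ('X * p)%R <= m.+1)%N.
  move=> pm; apply: leq_trans (size_polyMleq _ _) _.
  by rewrite size_polyX add2n.
rewrite chebS /=; split; apply: leq_trans (size_polyD _ _) _;
  rewrite geq_max ?size_polyN ?IH1 ?andbT ?sX //.
have s3 : (size (1 - 'X^2 : {poly R})%R <= 3)%N.
  apply: leq_trans (size_polyD _ _) _.
  by rewrite geq_max size_polyN size_polyXn size_poly1.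
apply: leq_trans (size_polyMleq _ _) _; rewrite -subn1 leq_subLR.
exact: leq_trans (leq_add s3 IH2) _.
Qed.

Lemma chebS_horner n x :
  (cheb n.+1).1.[x] = x * (cheb n).1.[x] - (1 - x ^+ 2) * (cheb n).2.[x] /\
  (cheb n.+1).2.[x] = x * (cheb n).2.[x] + (cheb n).1.[x].
Proof. by rewrite chebS /= !hornerE. Qed.

(** Pell's equation: the recurrence is multiplication of T + U sqrt(x^2 - 1) by x + sqrt(x^2 - 1),
    whose norm is 1. It replaces the cosine formula in the bound of T on [-1, 1]. *)
Lemma cheb_pell n x :
  (cheb n).1.[x] ^+ 2 + (1 - x ^+ 2) * (cheb n).2.[x] ^+ 2 = 1.
Proof.
elim: n => [|n IH].
  by rewrite /= horner0 expr0n mulr0 addr0 (_ : 1.[x] = 1) ?expr1n ?hornerE.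
have [-> ->] := chebS_horner n x; rewrite -[RHS]IH; ring.
Qed.

Lemma cheb_le1 n x : `|x| <= 1 -> `|(cheb n).1.[x]| <= 1.
Proof.
move=> x1; rewrite -(@expr_le1 _ 2) // real_normK ?num_real //.
rewrite -(cheb_pell n x) lerDl mulr_ge0 ?sqr_ge0 //.
by rewrite subr_ge0 -[x ^+ 2]real_normK ?num_real // expr_le1.
Qed.

(** With x = (z + w) / 2 and z w = 1, the root sqrt(x^2 - 1) is (z - w) / 2, so T + U sqrt(x^2 - 1)
    is z^n and its conjugate is w^n. The induction carries the sum and the difference of these two
    together. *)
Lemma cheb_joukowski n z w : z * w = 1 ->
  (cheb n).1.[(z + w) / 2] = (z ^+ n + w ^+ n) / 2.
Proof.
move=> zw.
suff : (cheb n).1.[(z + w) / 2] = (z ^+ n + w ^+ n) / 2 /\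
   (z - w) * (cheb n).2.[(z + w) / 2] = z ^+ n - w ^+ n by case.
elim: n => [|n [IH1 IH2]]; first by rewrite /= !hornerE !expr0 subrr; split=> //; field.
have [-> ->] := chebS_horner n ((z + w) / 2).
set x := (z + w) / 2 in IH1 IH2 *.
have xE : x = (z + w) / 2 by [].
set u := (cheb n).2.[x] in IH2 *; rewrite IH1.
have dE : 1 - x ^+ 2 = - ((z - w) / 2) ^+ 2.
  by rewrite -{1}zw /x; field.
split.
  rewrite dE exprMn [(z - w) ^+ 2]expr2.
  rewrite (_ : - _ * u = - ((z - w) / 4 * ((z - w) * u))); last by field.
  by rewrite IH2 xE !exprS; field.
by rewrite mulrDr mulrCA IH2 xE !exprS; field.
Qed.

(** The parameter [dl] is chosen by the caller so that a^2 - dl a folds the negative and the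
    positive part of the spectrum onto one positive interval; MINRES then converges in 2 k steps as
    Chebyshev iteration on that interval does in k. *)
Lemma minres_bound n (M : 'M[R]_n) (r0 r : 'cV[R]_n) (k : nat) (lo hi dl : R) :
  M^T = M -> 0 < lo < hi ->
  (forall a, eigenvalue M a -> lo ^+ 2 <= a ^+ 2 - dl * a <= hi ^+ 2) ->
  minres_residual M r0 (2 * k) r ->
  cnorm r <= 2 * ((hi - lo) / (hi + lo)) ^+ k * cnorm r0.
Proof.
move=> Msym /andP[lo0 lohi] hM [_ rmin].
have hi0 : 0 < hi by apply: lt_trans lohi.
have dpos : 0 < hi ^+ 2 - lo ^+ 2 by rewrite subr_gt0 ltr_sqr ?nnegrE ?ltW.
(* The affine map onto [-1, 1] sends 0 to (hi^2 + lo^2) / (hi^2 - lo^2), which is (z + 1 / z) / 2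
   for this [z]. Hence T_k there is at least z^k / 2, and its inverse at most 2 w^k. *)
pose z := (hi + lo) / (hi - lo); pose w := (hi - lo) / (hi + lo).
have hl : 0 < hi - lo by rewrite subr_gt0.
have hl' : 0 < hi + lo by rewrite addr_gt0.
have zw : z * w = 1 by rewrite /z /w; field; rewrite !gt_eqF.
have z0 : 0 < z by rewrite divr_gt0.
have w0 : 0 < w by rewrite divr_gt0.
(* [q] maps the interval [[lo^2, hi^2]] of values of [a^2 - dl a] onto [[-1, 1]],
   and 0 to [(z + w) / 2]. *)
pose al := - 2 / (hi ^+ 2 - lo ^+ 2).
pose q : {poly R} := al *: ('X^2 - dl *: 'X) + ((z + w) / 2)%:P.
pose c := (cheb k).1.[(z + w) / 2].
have cE : c = (z ^+ k + w ^+ k) / 2 by exact: cheb_joukowski.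
have c0 : 0 < c by rewrite cE divr_gt0 // addr_gt0 // exprn_gt0.
have cw : c^-1 <= 2 * w ^+ k.
  have -> : w = z^-1 by apply: (mulfI (lt0r_neq0 z0)); rewrite zw divff ?lt0r_neq0.
  rewrite exprVn -[2]invrK -invfM lef_pV2 ?posrE ?mulr_gt0 ?invr_gt0 ?exprn_gt0 //.
  by rewrite cE mulrC ler_pM2r ?invr_gt0 // lerDl exprn_ge0 // ltW.
pose p := c^-1 *: ((cheb k).1 \Po q).
have qE a : q.[a] = al * (a ^+ 2 - dl * a) + (z + w) / 2.
  by rewrite /q !hornerE.
have pE a : p.[a] = c^-1 * (cheb k).1.[q.[a]].
  by rewrite /p hornerZ horner_comp.
have hp : minres_poly (2 * k) p.
  split; last by rewrite pE qE expr0n !mulr0 subr0 mulr0 add0r mulVf ?gt_eqF.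
  rewrite size_scale ?invr_eq0 ?gt_eqF //.
  apply: leq_trans (size_comp_poly_leq _ _) _; rewrite ltnS mulnC.
  have sq : (size q <= 3)%N.
    apply: leq_trans (size_polyD _ _) _; rewrite geq_max.
    rewrite (leq_trans (size_polyC_leq1 _)) // andbT.
    apply: leq_trans (size_scale_leq _ _) _.
    apply: leq_trans (size_polyD _ _) _; rewrite geq_max size_polyXn size_polyN.
    by rewrite (leq_trans (size_scale_leq _ _)) // size_polyX.
  have [sT _] := size_cheb k.
  by apply: leq_mul; rewrite -subn1 leq_subLR.
apply: le_trans (rmin p hp) _.
apply: le_trans (_ : c^-1 * cnorm r0 <= _); last by rewrite ler_wpM2r ?sqrtr_ge0.
apply: real_symmetric_poly_bound => //; first by rewrite invr_ge0 ltW.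
move=> a /hM /andP[h1 h2]; rewrite pE normrM gtr0_norm ?invr_gt0 //.
rewrite ler_piMr ?invr_ge0 ?(ltW c0) // cheb_le1 // qE.
have -> : al * (a ^+ 2 - dl * a) + (z + w) / 2 =
   (hi ^+ 2 + lo ^+ 2 - 2 * (a ^+ 2 - dl * a)) / (hi ^+ 2 - lo ^+ 2).
  rewrite /al /z /w; field.
  by rewrite !gt_eqF.
rewrite ler_norml ler_pdivrMr // ler_pdivlMr // mul1r mulN1r; lra.
Qed.
End Chebyshev.

(** * Spectrum of the preconditioned saddle-point matrix *)

Section SpectralInclusion.
Variable R : realType.

Lemma sum_sqr_addZ (I : finType) (a b : I -> R) (c : R) :
  \sum_i (a i + c * b i) ^+ 2 =
  \sum_i a i ^+ 2 + 2 * c * (\sum_i a i * b i) + c ^+ 2 * \sum_i b i ^+ 2.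
Proof.
rewrite !mulr_sumr -!big_split /=; apply: eq_bigr => i _; ring.
Qed.

Lemma cauchy_schwarz_sum (I : finType) (a b : I -> R) :
  (\sum_i a i * b i) ^+ 2 <= (\sum_i a i ^+ 2) * \sum_i b i ^+ 2.
Proof.
set T := \sum_i a i * b i; set SA := \sum_i a i ^+ 2; set SB := \sum_i b i ^+ 2.
have SB0 : 0 <= SB by apply: sumr_ge0 => i _; exact: sqr_ge0.
have [SB_eq0|SBn0] := eqVneq SB 0.
  suff -> : T = 0 by rewrite expr0n mulr_ge0 // sumr_ge0 // => i _; exact: sqr_ge0.
  rewrite /T big1 // => i _; have /eqP := SB_eq0.
  rewrite psumr_eq0 => [|j _]; last exact: sqr_ge0.
  by move=> /allP/(_ i (mem_index_enum _)); rewrite sqrf_eq0 => /eqP ->; rewrite mulr0.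
have : 0 <= \sum_i (a i + - (T / SB) * b i) ^+ 2.
  by apply: sumr_ge0 => i _; exact: sqr_ge0.
rewrite sum_sqr_addZ -/T -/SA -/SB.
have -> : SA + 2 * - (T / SB) * T + (- (T / SB)) ^+ 2 * SB = SA - T ^+ 2 / SB.
  by field.
by rewrite subr_ge0 ler_pdivrMr // lt_def SBn0.
Qed.

(** Here [al], [pi] and [tau] stand for u^T A u, p^T M_p p and rho (w^T p)^2. For mu >= 1 the tested
    equation gives mu (mu - 1) pi <= (1 - mu)^2 al <= d pi, and d = m (m - 1) yields mu <= m; for 0
    < mu < 1 all its terms are nonnegative and one is positive. For mu = - nu < -1 the same
    comparison gives nu (nu + 1) <= d. *)
Lemma two_interval_scalar (al pi tau mu sg d m : R) :
  2 <= d -> 2 <= m -> m * (m - 1) = d -> 0 <= al -> 0 < pi -> 0 <= tau ->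
  0 < sg <= 2 / 3 ->
  (1 - mu) * al + mu * (pi + tau) + tau = 0 ->
  (1 - mu) ^+ 2 * al <= d * pi ->
  (mu <= 0 -> sg * (pi + tau) <= (1 - mu) ^+ 2 * al + tau) ->
  1 <= mu <= m \/ - (m - 1) <= mu <= - (sg / m).
Proof.
move=> d2 m2 md al0 pi0 tau0 /andP[sg0 sg1] eq bd lower.
have m0 : 0 < m by lra.
have [mu1|mu1] := lerP 1 mu.
  left => /=.
  have h : (mu - 1) * (mu * pi) <= d * pi.
    apply: le_trans bd; rewrite -sqrrN opprB expr2 -mulrA ler_wpM2l ?subr_ge0 //.
    nra.
  rewrite mulrA ler_pM2r // in h; nra.
have [mu0|mu0] := ltrP 0 mu; first by nra.
have {lower} := lower mu0 => lower.
have [nu muE] : exists nu, mu = - nu by exists (- mu); rewrite opprK.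
move: mu0 eq bd lower; rewrite {}muE oppr_le0 !opprK => nu0 eq bd lower.
have nuhi : nu <= m - 1.
  have [nu1|nu1] := lerP nu 1; first lra.
  have alE : (1 + nu) * al = nu * pi + (nu - 1) * tau by lra.
  have h : (1 + nu) * (nu * pi) <= d * pi.
    apply: le_trans bd; rewrite expr2 -mulrA ler_wpM2l ?addr_ge0 // alE lerDl.
    by rewrite mulr_ge0 // subr_ge0 ltW.
  rewrite mulrA ler_pM2r // in h; nra.
right; rewrite lerN2 nuhi lerN2 /= ler_pdivrMr //.
have [nu1|nu1] := lerP 1 nu; first nra.
(* Eliminating [al], the right side of [lower] becomes nu (1 + nu) pi + nu^2 tau. After division by
   pi + tau, 1 + nu < 2 <= m finishes. *)
have h : sg * (pi + tau) <= nu * (1 + nu) * (pi + tau).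
  apply: le_trans lower _.
  have -> : (1 + nu) ^+ 2 * al = (1 + nu) * (nu * pi + (nu - 1) * tau).
    by rewrite expr2 -mulrA; congr (_ * _); lra.
  nra.
rewrite ler_pM2r in h; last lra.
nra.
Qed.

(** Cauchy-Schwarz for the parts of [w] and [p] orthogonal to [one] gives (t - g x)^2 <= (1 - g^2)
    (P - x^2). Splitting g x as t - (t - g x) and applying Young's inequality bounds g^2 x^2, the
    constant part of g^2 P. *)
Lemma oblique_projection_bound n (one w p : 'cV[R]_n) (g : R) :
  \sum_i one i 0 ^+ 2 = 1 -> \sum_i w i 0 ^+ 2 = 1 ->
  \sum_i w i 0 * one i 0 = g ->
  g ^+ 2 * (\sum_i p i 0 ^+ 2) <= 3 * (\sum_i w i 0 * p i 0) ^+ 2 +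
    3 / 2 * (\sum_i p i 0 ^+ 2 - (\sum_i p i 0 * one i 0) ^+ 2).
Proof.
move=> o1 w1 wo; set x := \sum_i p i 0 * one i 0.
set t := \sum_i w i 0 * p i 0; set P := \sum_i p i 0 ^+ 2.
have := cauchy_schwarz_sum (fun i => w i 0 + - g * one i 0)
  (fun i => p i 0 + - x * one i 0).
rewrite !sum_sqr_addZ o1 w1 wo -/x -/P.
have -> y : \sum_i (w i 0 + - g * one i 0) * (p i 0 + - y * one i 0) =
    t - y * (\sum_i w i 0 * one i 0) - g * x + g * y * \sum_i one i 0 ^+ 2.
  rewrite /x /t !mulr_sumr -!sumrN -!big_split /=.
  apply: eq_bigr => i _; ring.
rewrite o1 wo.
have Y0 : 0 <= P - x ^+ 2.
  by rewrite subr_ge0 -[P]mulr1 -o1; exact: cauchy_schwarz_sum.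
(* The square of 3 t - g x is the defect in Young's inequality with weights 3 and 3 / 2. *)
have := mulr_ge0 (sqr_ge0 g) Y0; have := sqr_ge0 (3 * t - g * x).
nra.
Qed.

(** After multiplication by 2 / 3, the mean-zero part 3 / 2 [Y] is absorbed exactly. The part 3
    [t]^2 becomes 2 bt l t^2, at most rho t^2 / 3 by smallness of [L], which is what the remaining 2
    / 3 of rho t^2 leaves free. *)
Lemma schur_lower_scalar (bt l L rho g2 P Y t pi : R) :
  0 < bt <= 1 -> 0 < l -> l <= L -> 0 < rho -> 0 < g2 <= 1 ->
  L <= rho * g2 / 6 -> 0 < P -> pi <= L * P ->
  g2 * P <= 3 * t ^+ 2 + 3 / 2 * Y ->
  2 / 3 * (bt * (l / L) * g2) * (pi + rho * t ^+ 2) <=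
    bt * (l * Y) + rho * t ^+ 2.
Proof.
move=> /andP[bt0 bt1] l0 lL rho0 /andP[g20 g21] Lrho P0 piP ob.
have L0 : 0 < L by apply: lt_le_trans lL.
have t2 := sqr_ge0 t.
have bl0 : 0 < bt * l by rewrite mulr_gt0.
have r1 : l / L <= 1 by rewrite ler_pdivrMr // mul1r.
have r0 : 0 < bt * (l / L) by rewrite mulr_gt0 // divr_gt0.
set C := bt * (l / L) * g2.
have C0 : 0 < C by rewrite mulr_gt0.
have C1 : C <= 1.
  by apply: mulr_ile1; rewrite ?(ltW r0) ?(ltW g20) // mulr_ile1 // ltW // divr_gt0.
have CL : C * L = bt * l * g2 by rewrite /C; field; rewrite gt_eqF.
have h1 : C * pi <= bt * l * (g2 * P).
  apply: (@le_trans _ _ (C * (L * P))); first by rewrite ler_pM2l.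
  by rewrite !mulrA CL.
have h2 : bt * l * (g2 * P) <= bt * l * (3 * t ^+ 2 + 3 / 2 * Y).
  by rewrite ler_pM2l.
have h3 : bt * l <= rho / 6.
  apply: (@le_trans _ _ L).
    by apply: le_trans lL; rewrite -[leRHS]mul1r ler_pM2r.
  apply: le_trans Lrho _; rewrite ler_pM2r ?invr_gt0 //.
  by rewrite -[leRHS]mulr1 ler_pM2l.
have h4 : bt * l * t ^+ 2 <= rho / 6 * t ^+ 2 by rewrite ler_wpM2r.
have h5 : C * (rho * t ^+ 2) <= rho * t ^+ 2.
  by rewrite -[leRHS]mul1r ler_wpM2r // mulr_ge0 // ltW.
clear -h1 h2 h4 h5; lra.
Qed.

(** The parabola a^2 - (1 - b) a is symmetric about (1 - b) / 2, so it takes the same value b at -b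
    and at 1; its largest value is d + b md, at the end point md. *)
Lemma sqr_shift_bounds (d md b a : R) : 0 < b <= 1 -> 2 <= md ->
  md * (md - 1) = d ->
  1 <= a <= md \/ - (md - 1) <= a <= - b ->
  b <= a ^+ 2 - (1 - b) * a <= d + b * md.
Proof.
move=> /andP[b0 b1] md2 mdd [] /andP[h1 h2]; apply/andP; split; nra.
Qed.

(* [(hi - lo) / (hi + lo)] is the Chebyshev rate on [[lo^2, hi^2]], with
   [hi^2 / lo^2 = d / b + md]; the claim is [hi C1 <= lo sqrt d md], which after
   squaring amounts to [3 / 2 d C1 + C1^2 <= d md]. *)
Lemma rate_comparison (d md b s C1 lo hi : R) :
  2 <= d -> 2 <= md -> 0 < C1 <= 1 -> b * md = 2 / 3 * C1 ->
  s = Num.sqrt d * (2 * md) -> 0 < lo < hi ->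
  lo ^+ 2 = b -> hi ^+ 2 = d + b * md ->
  0 <= (s - 2 * C1) / (s + 2 * C1) /\
  (hi - lo) / (hi + lo) <= (s - 2 * C1) / (s + 2 * C1).
Proof.
move=> d2 md2 /andP[C0 C1le] bmd sE /andP[lo0 lohi] lo2 hi2.
have md0 : 0 < md by lra.
have hi0 : 0 < hi by apply: lt_trans lohi.
have d0 : 0 <= d by lra.
have sd1 : 1 <= Num.sqrt d by rewrite -[leLHS]sqrtr1 ler_sqrt; lra.
have sd2 : Num.sqrt d ^+ 2 = d by rewrite sqr_sqrtr.
set q := Num.sqrt d in sE sd1 sd2.
have q0 : 0 < q by lra.
have s4 : 4 <= s by rewrite sE; nra.
have key : hi * C1 <= lo * (q * md).
  rewrite -(@ler_pXn2r _ 2) ?nnegrE ?mulr_ge0 ?(ltW md0) ?(ltW C0) ?(ltW lo0)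
    ?(ltW hi0) ?(ltW q0) //.
  rewrite !exprMn lo2 hi2 sd2 bmd.
  have -> : b * (d * md ^+ 2) = 2 / 3 * C1 * (d * md) by rewrite -bmd; ring.
  (* Since C1 <= 1 and md >= 2, it suffices that d + 2 / 3 <= 4 / 3 d, that is, d >= 2. *)
  have h : (d + 2 / 3 * C1) * C1 <= 2 / 3 * (d * md).
    by clear -d2 md2 C0 C1le; nra.
  have := ler_wpM2r (ltW C0) h; clear; lra.
have s0 : 0 < s + 2 * C1 by lra.
split; first by rewrite divr_ge0 ?(ltW s0) //; lra.
rewrite ler_pdivrMr ?addr_gt0 // mulrAC ler_pdivlMr // sE.
clear -key; lra.
Qed.

End SpectralInclusion.

(** * Eigenvectors of the saddle-point pencil *)

Section SaddlePoint.
Variable R : realType.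

Lemma trmx11 (X : 'M[R]_1) : X 0 0 = X^T 0 0.
Proof. by rewrite mxE. Qed.

Lemma diag_formE n (m : 'rV[R]_n) (p : 'cV[R]_n) :
  (p^T *m diag_mx m *m p) 0 0 = \sum_i m 0 i * p i 0 ^+ 2.
Proof.
rewrite -mulmxA mxE; apply: eq_bigr => i _; rewrite mul_diag_mx !mxE; ring.
Qed.

Lemma rank1_formE n (w p : 'cV[R]_n) :
  (p^T *m (w *m w^T) *m p) 0 0 = (\sum_i w i 0 * p i 0) ^+ 2.
Proof.
have E : (w^T *m p) 0 0 = \sum_i w i 0 * p i 0.
  by rewrite mxE; apply: eq_bigr => i _; rewrite mxE.
have E' : (p^T *m w) 0 0 = \sum_i w i 0 * p i 0.
  by rewrite mxE; apply: eq_bigr => i _; rewrite mxE mulrC.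
by rewrite !mulmxA -mulmxA mxE big_ord_recl big_ord0 addr0 E E' expr2.
Qed.

Lemma rate_constant_bounds N (w one : 'cV[R]_N) (beta g l L : R) :
  0 < l -> l <= L -> 0 < beta -> beta < 1 ->
  \sum_i one i 0 ^+ 2 = 1 -> \sum_i w i 0 ^+ 2 = 1 ->
  \sum_i w i 0 * one i 0 = g -> g != 0 ->
  0 < beta ^+ 2 * (l / L) * g ^+ 2 <= 1.
Proof.
move=> l0 lL beta0 beta1 one1 w1 wone g0.
have L0 : 0 < L by apply: lt_le_trans lL.
have g2 : g ^+ 2 <= 1.
  by rewrite -[leRHS]mulr1 -{1}w1 -{1}one1 -wone; exact: cauchy_schwarz_sum.
have g2p : 0 < g ^+ 2 by rewrite lt_def sqr_ge0 sqrf_eq0 g0.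
have r1 : l / L <= 1 by rewrite ler_pdivrMr // mul1r.
have b0 : 0 < beta ^+ 2 by rewrite exprn_gt0.
have b1 : beta ^+ 2 <= 1 by rewrite expr_le1 // ltW.
have br : 0 < beta ^+ 2 * (l / L) by rewrite mulr_gt0 // divr_gt0.
rewrite mulr_gt0 //=; apply: mulr_ile1; rewrite ?(ltW br) ?(ltW g2p) //.
by apply: mulr_ile1 => //; rewrite ltW // divr_gt0.
Qed.

Lemma saddle_spectrum n N (A : 'M[R]_n) (B : 'M[R]_(N, n)) (m : 'rV[R]_N)
    (w one : 'cV[R]_N) (d rho beta g l L md mu : R) (y : 'cV[R]_(n + N)) :
  A^T = A -> (forall u : 'cV[R]_n, u != 0 -> 0 < (u^T *m A *m u) 0 0) ->
  0 < l -> (forall i, l <= m 0 i <= L) -> 0 < L ->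
  \sum_i one i 0 ^+ 2 = 1 -> \sum_i w i 0 ^+ 2 = 1 ->
  \sum_i w i 0 * one i 0 = g -> g != 0 -> \sum_i m 0 i * one i 0 != 0 ->
  0 < rho -> L <= rho * g ^+ 2 / 6 -> 0 < beta < 1 ->
  2 <= d -> 2 <= md -> md * (md - 1) = d ->
  (forall (u : 'cV_n) (p : 'cV_N), (p^T *m B *m u) 0 0 ^+ 2 <=
     d * (p^T *m diag_mx m *m p) 0 0 * (u^T *m A *m u) 0 0) ->
  (forall (q : 'cV_N) (u : 'cV_n), \sum_i m 0 i * q i 0 = 0 -> B^T *m q = A *m u ->
     beta ^+ 2 * (q^T *m diag_mx m *m q) 0 0 <= (u^T *m A *m u) 0 0) ->
  B^T *m one = 0 ->
  block_mx A (- B^T) (- B) (- (rho *: (w *m w^T))) *m y =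
    mu *: (block_mx A 0 0 (rho *: (w *m w^T) + diag_mx m) *m y) ->
  y != 0 ->
  1 <= mu <= md \/
  - (md - 1) <= mu <= - (2 / 3 * (beta ^+ 2 * (l / L) * g ^+ 2) / md).
Proof.
move=> Asym Apd l0 mlL L0 one1 w1 wone g0 mone rho0 Lrho /andP[beta0 beta1]
  d2 md2 mdd cont infsup B1 eq y0.
pose u := usubmx y; pose p := dsubmx y.
rewrite -[y]vsubmxK -/u -/p !mul_block_col scale_col_mx !mul0mx addr0 add0r in eq.
have [equ eqp] := eq_col_mx eq.
set W := rho *: (w *m w^T) in eqp.
have Am0 (v : 'cV[R]_n) : 0 <= (v^T *m A *m v) 0 0.
  have [->|v0] := eqVneq v 0; first by rewrite mulmx0 mxE.
  exact/ltW/Apd.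
pose al := (u^T *m A *m u) 0 0.
pose pi := (p^T *m diag_mx m *m p) 0 0.
pose t := \sum_i w i 0 * p i 0.
have tauE : (p^T *m W *m p) 0 0 = rho * t ^+ 2.
  by rewrite /W -scalemxAr -scalemxAl mxE rank1_formE.
(* The first block row is A u - B^T p = mu A u. This form serves twice: tested with u it gives p^T B
   u, and it exhibits the vector whose energy the inf-sup condition controls. *)
have BTp : B^T *m p = A *m ((1 - mu) *: u).
  rewrite -scalemxAr scalerBl scale1r -equ.
  by rewrite opprD addrA subrr add0r mulNmx opprK.
have BTE : (p^T *m B *m u) 0 0 = (1 - mu) * al.
  rewrite trmx11 !trmx_mul trmxK BTp -scalemxAr -scalemxAr mxE.
  by rewrite /al -mulmxA.
have scaE c (X : 'M[R]_1) : (c *: X) 0 0 = c * X 0 0 by rewrite mxE.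
have eqs : (1 - mu) * al + mu * (pi + rho * t ^+ 2) + rho * t ^+ 2 = 0.
  have addE (X Y : 'M[R]_1) : (X + Y) 0 0 = X 0 0 + Y 0 0 by rewrite mxE.
  have oppE (X : 'M[R]_1) : (- X) 0 0 = - X 0 0 by rewrite mxE.
  have := congr1 (fun z => (p^T *m z) 0 0) eqp.
  rewrite mulmxDr -scalemxAr !mulNmx !mulmxN mulmxDl mulmxDr !mulmxA.
  rewrite scaE !addE !oppE -/pi tauE BTE => h.
  by clear -h; lra.
have bd : (1 - mu) ^+ 2 * al <= d * pi.
  have := cont u p; rewrite BTE -/al -/pi => h.
  have [al0|al0] := eqVneq al 0.
    rewrite al0 mulr0 mulr_ge0 //; first lra.
    rewrite /pi diag_formE sumr_ge0 // => i _; rewrite mulr_ge0 ?sqr_ge0 //.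
    by case/andP: (mlL i) => h1 _; apply: le_trans h1; exact: ltW.
  have alp : 0 < al by rewrite lt_def al0 Am0.
  by rewrite -(ler_pM2r alp) -mulrA -expr2 -exprMn.
have piE : pi = \sum_i m 0 i * p i 0 ^+ 2 by exact: diag_formE.
(* A vanishing pressure forces mu = 1, the left end of the positive interval. *)
have [p0|p0] := eqVneq p 0.
  have u0 : u != 0.
    apply: contraNneq y0 => u0; rewrite -[y]vsubmxK -/u -/p u0 p0.
    by rewrite col_mx0.
  have alp : 0 < al by exact: Apd.
  have pi0 : pi = 0 by rewrite /pi p0 mulmx0 mxE.
  have t0 : t = 0 by rewrite /t big1 // => i _; rewrite p0 mxE mulr0.
  move: eqs; rewrite pi0 t0 expr0n /= !(mulr0, addr0) => /eqP.
  rewrite mulf_eq0 (gt_eqF alp) orbF subr_eq0 => /eqP <-; left; lra.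
pose P := \sum_i p i 0 ^+ 2.
have P0 : 0 < P.
  rewrite lt_def /P sumr_ge0 ?andbT => [|i _]; last exact: sqr_ge0.
  apply: contra p0; rewrite psumr_eq0 => [|i _]; last exact: sqr_ge0.
  move=> /allP h; apply/eqP/matrixP => i j; rewrite ord1 [RHS]mxE.
  by have := h i (mem_index_enum _); rewrite sqrf_eq0 => /eqP.
have pilo : l * P <= pi.
  rewrite /P mulr_sumr piE; apply: ler_sum => i _; rewrite ler_wpM2r ?sqr_ge0 //.
  by case/andP: (mlL i).
have pihi : pi <= L * P.
  rewrite /P mulr_sumr piE; apply: ler_sum => i _; rewrite ler_wpM2r ?sqr_ge0 //.
  by case/andP: (mlL i).
have pi0 : 0 < pi by apply: lt_le_trans pilo; rewrite mulr_gt0.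
have lL : l <= L.
  by rewrite -(ler_pM2r P0); apply: le_trans pilo pihi.
set sg := 2 / 3 * (beta ^+ 2 * (l / L) * g ^+ 2).
have b2 : 0 < beta ^+ 2 <= 1 by rewrite exprn_gt0 //= expr_le1 // ltW.
have g2 : g ^+ 2 <= 1.
  by rewrite -[leRHS]mulr1 -{1}w1 -{1}one1 -wone; exact: cauchy_schwarz_sum.
have C0 := rate_constant_bounds l0 lL beta0 beta1 one1 w1 wone g0.
have sgb : 0 < sg <= 2 / 3 by clear -C0; rewrite /sg; lra.
apply: (@two_interval_scalar _ al pi (rho * t ^+ 2) mu sg d md) => //.
- exact: Am0.
- by rewrite mulr_ge0 ?sqr_ge0 // ltW.
move=> _.
(* Subtracting [c] times [one] makes the integral of the pressure vanish, which is a mean weighted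
   by the volumes; it does not change B^T p because [one] lies in the kernel. *)
pose c := (\sum_i m 0 i * p i 0) / (\sum_i m 0 i * one i 0).
pose q := p - c *: one.
have q0 : \sum_i m 0 i * q i 0 = 0.
  transitivity (\sum_i m 0 i * p i 0 - c * \sum_i m 0 i * one i 0).
    rewrite mulr_sumr -sumrN -big_split /=; apply: eq_bigr => i _.
    by rewrite !mxE; ring.
  by rewrite /c divfK // subrr.
have BTq : B^T *m q = A *m ((1 - mu) *: u).
  by rewrite mulmxBr -scalemxAr B1 scaler0 subr0.
have := infsup _ _ q0 BTq.
have -> : ((1 - mu) *: u)^T = (1 - mu) *: u^T by apply/matrixP => i j; rewrite !mxE.
rewrite diag_formE -!scalemxAl -scalemxAr scalerA scaE -expr2 -/al => h.
apply: le_trans (lerD h (lexx _)).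
pose x := \sum_i p i 0 * one i 0.
have Y0 : 0 <= P - x ^+ 2.
  by rewrite subr_ge0 -[P]mulr1 -one1; exact: cauchy_schwarz_sum.
(* The weighted projection differs from the Euclidean one, but the latter minimizes the distance to
   the constants: the excess is (x - c)^2. *)
have Qlo : l * (P - x ^+ 2) <= \sum_i m 0 i * q i 0 ^+ 2.
  apply: (@le_trans _ _ (l * \sum_i q i 0 ^+ 2)).
    rewrite ler_pM2l //.
    have -> : \sum_i q i 0 ^+ 2 = \sum_i (p i 0 + - c * one i 0) ^+ 2.
      by apply: eq_bigr => i _; rewrite !mxE mulNr.
    rewrite sum_sqr_addZ one1 -/P -/x.
    rewrite -subr_ge0 (_ : _ - _ = (x - c) ^+ 2) ?sqr_ge0 //; ring.
  rewrite mulr_sumr; apply: ler_sum => i _; rewrite ler_wpM2r ?sqr_ge0 //.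
  by case/andP: (mlL i).
have := oblique_projection_bound p one1 w1 wone; rewrite -/P -/x -/t => ob.
apply: (@le_trans _ _ (beta ^+ 2 * (l * (P - x ^+ 2)) + rho * t ^+ 2)).
  have g2p : 0 < g ^+ 2 <= 1 by rewrite g2 andbT lt_def sqr_ge0 sqrf_eq0 g0.
  exact: (schur_lower_scalar b2 l0 lL rho0 g2p Lrho P0 pihi ob).
by rewrite lerD2r ler_pM2l //; case/andP: b2.
Qed.
End SaddlePoint.

(** * From the pencil to the residual of preconditioned MINRES *)

Section PreconditionedMinres.
Variable R : realType.

Lemma pd_unitmx n (M : 'M[R]_n) :
  (forall v : 'cV[R]_n, v != 0 -> 0 < (v^T *m M *m v) 0 0) -> M \in unitmx.
Proof.
move=> Mpd; rewrite -row_free_unit -kermx_eq0.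
apply/negPn/negP => K0; have := nz_row_eq0 (kermx M); rewrite (negbTE K0).
move=> /negbT v0; have /sub_kermxP vM : (nz_row (kermx M) <= kermx M)%MS.
  exact: nz_row_sub.
have : (nz_row (kermx M))^T != 0 by rewrite trmx_eq0.
by move=> /Mpd; rewrite trmxK vM mul0mx mxE ltxx.
Qed.

(** The inverse square root [H] certifies that [P] is symmetric positive definite; the definiteness
    of the block A is obtained from this. *)
Lemma invsqrt_spd n (P H : 'M[R]_n) : is_invsqrt P H ->
  [/\ H \in unitmx, P = invmx H *m invmx H & spd P].
Proof.
move=> [[Hsym Hpd] HH].
have Hu := pd_unitmx Hpd.
(* By convention [invmx P] is [P] itself for singular [P]; then P = H H would be invertible all the
   same. *)
have Pu : P \in unitmx.
  apply/negPn/negP => Pn; move: HH; rewrite /invmx (negbTE Pn) => HP.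
  by move: Pn; rewrite -HP unitmx_mul Hu.
have PE : P = invmx H *m invmx H.
  apply: (can_inj (mulmxK (m := n) Hu)); rewrite mulmxKV //.
  apply: (can_inj (mulmxK (m := n) Hu)); rewrite mulVmx // -mulmxA HH mulmxV //.
split=> //; split; first by rewrite PE trmx_mul trmx_inv Hsym.
move=> v v0; rewrite PE mulmxA.
have -> : v^T *m invmx H *m invmx H *m v = (invmx H *m v)^T *m (invmx H *m v).
  by rewrite trmx_mul trmx_inv Hsym !mulmxA.
set u := invmx H *m v.
have u0 : u != 0.
  apply: contraNneq v0 => u0; rewrite -[v]mul1mx -(mulmxV Hu) -mulmxA -/u u0.
  by rewrite mulmx0.
have -> : (u^T *m u) 0 0 = \sum_i u i 0 ^+ 2.
  by rewrite mxE; apply: eq_bigr => i _; rewrite mxE expr2.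
rewrite lt_def sumr_ge0 ?andbT => [|i _]; last exact: sqr_ge0.
apply: contra u0; rewrite psumr_eq0 => [|i _]; last exact: sqr_ge0.
move=> /allP h; apply/eqP/matrixP => i j; rewrite ord1 [RHS]mxE.
by have := h i (mem_index_enum _); rewrite sqrf_eq0 => /eqP.
Qed.

Lemma spd_ulblock n N (A : 'M[R]_n) (S : 'M[R]_N) :
  spd (block_mx A 0 0 S) -> spd A.
Proof.
move=> [sym pd]; split.
  by move: sym; rewrite tr_block_mx => /eq_block_mx[].
move=> u u0; have := pd (col_mx u 0).
rewrite tr_col_mx trmx0 mul_row_block !(mulmx0, mul0mx, addr0) mul_row_col.
rewrite mul0mx addr0; apply; apply: contra u0.
by move=> /eqP; rewrite -col_mx0 => /eq_col_mx[-> _].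
Qed.

Lemma preconditioned_eigenvector n (M P H : 'M[R]_n) a : M^T = M ->
  is_invsqrt P H -> eigenvalue (H *m M *m H) a ->
  exists2 y : 'cV[R]_n, M *m y = a *: (P *m y) & y != 0.
Proof.
move=> Msym HP /eigenvalueP[v vE v0].
have [Hu PE _] := invsqrt_spd HP; have [[Hsym _] _] := HP.
exists (H *m v^T); last first.
  apply: contra v0 => /eqP h; apply/eqP/trmx_inj.
  by rewrite -[v^T]mul1mx -(mulVmx Hu) -mulmxA h mulmx0 trmx0.
have := congr1 trmx vE; rewrite !trmx_mul Hsym Msym => h.
have {}h : H *m (M *m (H *m v^T)) = a *: v^T.
  rewrite !mulmxA; rewrite !mulmxA in h; rewrite h.
  by apply/matrixP => i j; rewrite !mxE.
by rewrite PE -[invmx H *m _ *m _]mulmxA mulKmx // scalemxAr -h mulKmx.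
Qed.

(** The algebraic core, free of meshes. The inf-sup hypothesis is conditional on [spd A] because
    definiteness becomes available only through [H]. *)
Lemma stokes_minres_rate n N (A : 'M[R]_n) (B : 'M[R]_(N, n)) (m : 'rV[R]_N)
    (w one : 'cV[R]_N) (d rho beta g l L s C1 : R) (H : 'M[R]_(n + N))
    (r0 r : 'cV[R]_(n + N)) (k : nat) :
  0 < l -> l <= L -> (forall i, l <= m 0 i <= L) ->
  \sum_i one i 0 ^+ 2 = 1 -> \sum_i w i 0 ^+ 2 = 1 ->
  \sum_i w i 0 * one i 0 = g -> g != 0 -> \sum_i m 0 i * one i 0 != 0 ->
  0 < rho -> L <= rho * g ^+ 2 / 6 -> 0 < beta < 1 -> 2 <= d ->
  (forall (u : 'cV_n) (p : 'cV_N), (p^T *m B *m u) 0 0 ^+ 2 <=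
     d * (p^T *m diag_mx m *m p) 0 0 * (u^T *m A *m u) 0 0) ->
  (spd A -> forall (q : 'cV_N) (u : 'cV_n),
     \sum_i m 0 i * q i 0 = 0 -> B^T *m q = A *m u ->
     beta ^+ 2 * (q^T *m diag_mx m *m q) 0 0 <= (u^T *m A *m u) 0 0) ->
  B^T *m one = 0 ->
  is_invsqrt (block_mx A 0 0 (rho *: (w *m w^T) + diag_mx m)) H -> r0 != 0 ->
  minres_residual
    (H *m block_mx A (- B^T) (- B) (- (rho *: (w *m w^T))) *m H) r0 (2 * k) r ->
  s = Num.sqrt d * (1 + Num.sqrt (1 + 4 * d)) ->
  C1 = beta ^+ 2 * (l / L) * g ^+ 2 ->
  cnorm r / cnorm r0 <= 2 * ((s - 2 * C1) / (s + 2 * C1)) ^+ k.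
Proof.
move=> l0 lL mlL one1 w1 wone g0 mone rho0 Lrho beta01 d2 cont infsup B1 HP.
move=> r00 hr sdef C1def.
have L0 : 0 < L by apply: lt_le_trans lL.
have /andP[C0 C1le] : 0 < C1 <= 1.
  rewrite C1def.
  by case/andP: (beta01) => b0 b1; apply: rate_constant_bounds wone g0.
have [_ _ Pspd] := invsqrt_spd HP.
have [Asym Apd] := spd_ulblock Pspd.
set M := block_mx A (- B^T) _ _ in hr.
have Msym : M^T = M.
  rewrite /M tr_block_mx !linearN /= trmxK Asym; congr (block_mx _ _ _ (- _)).
  by apply/matrixP => i j; rewrite !mxE; congr (_ * _); apply: eq_bigr => e _;
    rewrite !mxE mulrC.
have Xsym : (H *m M *m H)^T = H *m M *m H.
  by have [[Hsym _] _] := HP; rewrite !trmx_mul Hsym Msym mulmxA.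
pose q := Num.sqrt (1 + 4 * d); pose md := (1 + q) / 2.
have q2 : q ^+ 2 = 1 + 4 * d by rewrite sqr_sqrtr //; lra.
have q0 : 0 <= q by exact: sqrtr_ge0.
have md2 : 2 <= md.
  have : 3 <= q by rewrite -(@ler_pXn2r _ 2) ?nnegrE // q2; lra.
  rewrite /md; lra.
have mdd : md * (md - 1) = d.
  have : md * (md - 1) = (q ^+ 2 - 1) / 4 by rewrite /md; field.
  by rewrite q2 => ->; field.
have sE : s = Num.sqrt d * (2 * md) by rewrite sdef /md -/q; congr (_ * _); field.
clearbody md.
have md0 : 0 < md by lra.
pose b := 2 / 3 * C1 / md.
have b0 : 0 < b by rewrite divr_gt0 // mulr_gt0 // divr_gt0.
have b1 : b <= 1 by rewrite ler_pdivrMr //; lra.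
have bmd : b * md = 2 / 3 * C1 by rewrite divfK // gt_eqF.
pose lo := Num.sqrt b; pose hi := Num.sqrt (d + b * md).
have lo2 : lo ^+ 2 = b by rewrite sqr_sqrtr // ltW.
have hi2 : hi ^+ 2 = d + b * md by rewrite sqr_sqrtr //; nra.
have lohi : 0 < lo < hi by rewrite sqrtr_gt0 b0 /= ltr_sqrt; nra.
have spec a : eigenvalue (H *m M *m H) a ->
    lo ^+ 2 <= a ^+ 2 - (1 - b) * a <= hi ^+ 2.
  move=> /(preconditioned_eigenvector Msym HP) [y yE y0].
  have := saddle_spectrum Asym Apd l0 mlL L0 one1 w1 wone g0 mone rho0 Lrho
    beta01 d2 md2 mdd cont (infsup (conj Asym Apd)) B1 yE y0.
  rewrite -C1def -/b lo2 hi2; apply: sqr_shift_bounds; rewrite ?b0 //.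
have := minres_bound Xsym lohi spec hr.
have r0n : 0 < cnorm r0.
  rewrite /cnorm /enorm sqrtr_gt0 /dotr lt_def sumr_ge0 ?andbT; last first.
    by move=> i _; rewrite -expr2 sqr_ge0.
  apply: contra r00; rewrite psumr_eq0 => [|i _]; last by rewrite -expr2 sqr_ge0.
  move=> /allP h; apply/eqP/matrixP => i j; rewrite ord1 [RHS]mxE.
  have := h i (mem_index_enum _).
  by rewrite !mxE /= -expr2 sqrf_eq0 => /eqP.
rewrite -ler_pdivrMr // => /le_trans; apply.
have [rate0 rate] :=
  rate_comparison d2 md2 (introT andP (conj C0 C1le)) bmd sE lohi lo2 hi2.
case/andP: lohi => lo0 lohi; have hi0 : 0 < hi by apply: lt_trans lohi.
rewrite ler_pM2l //; apply: lerXn2r => //.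
by rewrite nnegrE divr_ge0 ?subr_ge0 ?(ltW lohi) // ltW // addr_gt0.
Qed.
End PreconditionedMinres.

(** * Polynomial integrals over simplices *)

Section PolynomialIntegrals.
Variable R : realType.

Lemma Rintegral_horner (q Q : {poly R}) (s : R) : Q^`() = q -> 0 <= s ->
  \int[lebesgue_measure]_(t in `[0, s]) q.[t] = Q.[s] - Q.[0].
Proof.
move=> dQ; rewrite le_eqVlt => /predU1P[<-|s0].
  by rewrite set_itv1 Rintegral_set1 subrr.
rewrite /Rintegral (@continuous_FTC2 _ (horner q) (horner Q)) //.
- apply/continuous_subspaceT => x; exact: continuous_horner.
- split.
  + by move=> x _; exact: derivable_horner.
  + by apply: cvg_at_right_filter; exact: continuous_horner.
  + by apply: cvg_at_left_filter; exact: continuous_horner.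
- by move=> x _; rewrite -dQ derivE.
Qed.

(** The Beta integral of t^a (1 - t)^e over [0, 1], equal to a! e! / (a + e + 1)!, in the recursive
    form produced by integration by parts. *)
Fixpoint beta_coef (a e : nat) : R :=
  if e is e'.+1 then e'.+1%:R / a.+1%:R * beta_coef a.+1 e' else a.+1%:R^-1.

Lemma beta_primitive (s : R) (a e : nat) : exists Q : {poly R},
  Q^`() = 'X^a * (s%:P - 'X) ^+ e /\
  Q.[s] - Q.[0] = beta_coef a e * s ^+ (a + e).+1.
Proof.
elim: e a => [|e IH] a.
  exists (a.+1%:R^-1 *: 'X^(a.+1)); split.
    rewrite expr0 mulr1 derivZ derivXn /= -['X^a *+ _]scaler_nat scalerA.
    by rewrite mulVf ?scale1r // pnatr_eq0.
  by rewrite !hornerZ !hornerXn expr0n mulr0 subr0 addn0.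
have [Q [dQ QE]] := IH a.+1.
exists (a.+1%:R^-1 *: ('X^(a.+1) * (s%:P - 'X) ^+ e.+1) + (e.+1%:R / a.+1%:R) *: Q).
have an0 : a.+1%:R != 0 :> R by rewrite pnatr_eq0.
split.
  have E : ('X^(a.+1) * (s%:P - 'X) ^+ e.+1)^`() =
      a.+1%:R *: ('X^a * (s%:P - 'X) ^+ e.+1) - e.+1%:R *: ('X^(a.+1) * (s%:P - 'X) ^+ e).
    rewrite !scaler_nat derivM derivXn deriv_exp derivB derivC derivX sub0r /=.
    by rewrite mulN1r mulNrn mulrN mulrnAl mulrnAr.
  rewrite derivD !derivZ dQ E scalerBr !scalerA mulVf // scale1r.
  by rewrite [_^-1 * _]mulrC subrK.
rewrite !hornerD !hornerZ !hornerM !horner_exp !hornerD !hornerN !hornerC !hornerX.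
rewrite subrr !expr0n /= mulr0 mul0r !mulr0 !add0r -mulrBr QE.
by rewrite addSn addnS mulrA.
Qed.

(** Exponents are indexed by all of [nat], so that peeling off the first variable is the shift
    [a \o S], with no cast between ordinal types. *)
Definition monomial m (a : nat -> nat) (y : 'rV[R]_m) : R := \prod_(i < m) y 0 i ^+ a i.

Definition monomial_sum m (l : seq (R * (nat -> nat))) (y : 'rV[R]_m) : R :=
  \sum_(p <- l) p.1 * monomial p.2 y.

Fixpoint dirichlet_deg (m : nat) (a : nat -> nat) : nat :=
  if m is m'.+1 then (a 0 + dirichlet_deg m' (a \o S)).+1 else 0.

(** Dirichlet's constant: the product of the a_i! divided by (m + sum of the a_i)!. *)
Fixpoint dirichlet_coef (m : nat) (a : nat -> nat) : R :=
  if m is m'.+1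
  then beta_coef (a 0) (dirichlet_deg m' (a \o S)) * dirichlet_coef m' (a \o S) else 1.

Lemma monomial_row_mx m (a : nat -> nat) (t : R) (y : 'rV[R]_m) :
  monomial a (row_mx t%:M y : 'rV_(1 + m)) = t ^+ a 0 * monomial (a \o S) y.
Proof.
rewrite /monomial (big_ord_recl m); congr (_ * _).
  have -> : ord0 = lshift m (ord0 : 'I_1) by apply/val_inj.
  by rewrite row_mxEl mxE eqxx mulr1n.
apply: eq_bigr => i _; have -> : lift ord0 i = rshift 1 i by apply/val_inj.
by rewrite row_mxEr.
Qed.

(** The induction is on whole sums, since linearity of the iterated integral is a consequence of
    this formula. The inner integral is a polynomial in t and s - t, which has a polynomial
    primitive. *)
Lemma ref_simplex_int_monomial_sum m (l : seq (R * (nat -> nat))) (s : R) : 0 <= s ->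
  ref_simplex_int s (@monomial_sum m l) =
  \sum_(p <- l) p.1 * (dirichlet_coef m p.2 * s ^+ dirichlet_deg m p.2).
Proof.
elim: m l s => [|m IH] l s s0.
  by rewrite /monomial_sum /=; apply: eq_bigr => p _; rewrite /monomial big_ord0 expr0 !mulr1.
pose q : {poly R} := \sum_(p <- l) (p.1 * dirichlet_coef m (p.2 \o S)) *:
  ('X^(p.2 0) * (s%:P - 'X) ^+ dirichlet_deg m (p.2 \o S)).
have -> : ref_simplex_int s (@monomial_sum m.+1 l) =
    \int[lebesgue_measure]_(t in `[0, s]) q.[t].
  rewrite /=; apply: eq_Rintegral => t; rewrite inE /= in_itv /= => /andP[t0 ts].
  transitivity (ref_simplex_int (s - t)
      (@monomial_sum m [seq (p.1 * t ^+ p.2 0, p.2 \o S) | p <- l])).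
    congr ref_simplex_int; apply/funext => y; rewrite /monomial_sum big_map.
    by apply: eq_bigr => p _; rewrite monomial_row_mx mulrA.
  rewrite IH ?subr_ge0 // big_map /q horner_sum; apply: eq_bigr => p _ /=.
  rewrite hornerZ hornerM !horner_exp hornerD hornerN hornerC !hornerX; ring.
have /choice[Q dQ] := fun p : R * (nat -> nat) =>
  beta_primitive s (p.2 0) (dirichlet_deg m (p.2 \o S)).
have QE : (\sum_(p <- l) (p.1 * dirichlet_coef m (p.2 \o S)) *: Q p)^`() = q.
  rewrite (raddf_sum (@deriv R)); apply: eq_bigr => p _; rewrite /= derivZ.
  by have [-> _] := dQ p.
rewrite (Rintegral_horner QE s0) !horner_sum -sumrB; apply: eq_bigr => p _.
rewrite !hornerZ -mulrBr; have [_ ->] := dQ p; rewrite /=; ring.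
Qed.


Definition polyfun m (f : 'rV[R]_m -> R) : Prop := exists l, f = monomial_sum l.

Lemma polyfun_cst m (c : R) : @polyfun m (fun=> c).
Proof.
exists [:: (c, fun=> 0%N)]; apply/funext => y.
by rewrite /monomial_sum big_seq1 /monomial big1 ?mulr1.
Qed.

Lemma polyfun_coord m (j : 'I_m) : @polyfun m (fun y => y 0 j).
Proof.
exists [:: (1, fun i => (i == j :> nat) : nat)]; apply/funext => y.
rewrite /monomial_sum big_seq1 /monomial mul1r (bigD1 j) //= eqxx expr1 big1 ?mulr1 // => i.
by move=> /negbTE; rewrite -val_eqE /= => ->.
Qed.

Lemma polyfunD m (f g : 'rV[R]_m -> R) : polyfun f -> polyfun g ->
  polyfun (fun y => f y + g y).
Proof.
move=> [l ->] [l' ->]; exists (l ++ l'); apply/funext => y.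
by rewrite /monomial_sum big_cat.
Qed.

Lemma polyfunM m (f g : 'rV[R]_m -> R) : polyfun f -> polyfun g ->
  polyfun (fun y => f y * g y).
Proof.
move=> [l ->] [l' ->].
exists [seq (p.1 * q.1, fun i => (p.2 i + q.2 i)%N) | p <- l, q <- l'].
apply/funext => y; rewrite /monomial_sum big_allpairs_dep mulr_suml; apply: eq_bigr => p _.
rewrite mulr_sumr; apply: eq_bigr => q _ /=; rewrite mulrACA; congr (_ * _).
by rewrite /monomial -big_split; apply: eq_bigr => i _; rewrite exprD.
Qed.

Lemma polyfunZ m c (f : 'rV[R]_m -> R) : polyfun f -> polyfun (fun y => c * f y).
Proof. exact/polyfunM/polyfun_cst. Qed.

Lemma polyfun_sum m I (r : seq I) (P : pred I) (F : I -> 'rV[R]_m -> R) :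
  (forall i, polyfun (F i)) -> polyfun (fun y => \sum_(i <- r | P i) F i y).
Proof.
move=> h; elim: r => [|i r IH].
  rewrite (_ : (fun y => _) = fun=> 0); first exact: polyfun_cst.
  by apply/funext => y; rewrite big_nil.
case Pi : (P i); last first.
  rewrite (_ : (fun y => _) = fun y => \sum_(i <- r | P i) F i y) //.
  by apply/funext => y; rewrite big_cons Pi.
rewrite (_ : (fun y => _) = fun y => F i y + \sum_(i <- r | P i) F i y).
  exact: polyfunD.
by apply/funext => y; rewrite big_cons Pi.
Qed.

Lemma polyfunX m (f : 'rV[R]_m -> R) k : polyfun f -> polyfun (fun y => f y ^+ k).
Proof.
move=> h; elim: k => [|k IH].
  rewrite (_ : (fun y => _) = fun=> 1); first exact: polyfun_cst.
  by apply/funext => y; rewrite expr0.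
rewrite (_ : (fun y => _) = fun y => f y * f y ^+ k); first exact: polyfunM.
by apply/funext => y; rewrite exprS.
Qed.

Lemma polyfun_comp m n (f : 'rV[R]_n -> R) (h : 'rV[R]_m -> 'rV[R]_n) :
  polyfun f -> (forall j, polyfun (fun y => h y 0 j)) -> polyfun (fun y => f (h y)).
Proof.
move=> [l ->] hh; apply: polyfun_sum => p; apply: polyfunZ.
rewrite /monomial; elim: (index_enum _) => [|i r IH].
  rewrite (_ : (fun y => _) = fun=> 1); first exact: polyfun_cst.
  by apply/funext => y; rewrite big_nil.
rewrite (_ : (fun y => _) = fun y => h y 0 i ^+ p.2 i * \prod_(j <- r) h y 0 j ^+ p.2 j).
  by apply: polyfunM => //; exact: polyfunX.
by apply/funext => y; rewrite big_cons.
Qed.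

Lemma ref_simplex_intD m (f g : 'rV[R]_m -> R) (s : R) : 0 <= s ->
  polyfun f -> polyfun g ->
  ref_simplex_int s (fun y => f y + g y) =
  ref_simplex_int s f + ref_simplex_int s g.
Proof.
move=> s0 [l ->] [l' ->].
rewrite (_ : (fun y => _) = monomial_sum (l ++ l')); last first.
  by apply/funext => y; rewrite /monomial_sum big_cat.
by rewrite !ref_simplex_int_monomial_sum // big_cat.
Qed.

Lemma ref_simplex_intZ m c (f : 'rV[R]_m -> R) (s : R) : 0 <= s -> polyfun f ->
  ref_simplex_int s (fun y => c * f y) = c * ref_simplex_int s f.
Proof.
move=> s0 [l ->].
rewrite (_ : (fun y => _) = monomial_sum [seq (c * p.1, p.2) | p <- l]); last first.
  apply/funext => y; rewrite /monomial_sum big_map mulr_sumr.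
  by apply: eq_bigr => p _; rewrite mulrA.
rewrite !ref_simplex_int_monomial_sum // big_map mulr_sumr; apply: eq_bigr => p _ /=.
by rewrite !mulrA.
Qed.

Lemma ref_simplex_int_ge0 m (f : 'rV[R]_m -> R) (s : R) : (forall y, 0 <= f y) ->
  0 <= ref_simplex_int s f.
Proof.
elim: m f s => [|m IH] f s f0 /=; first exact: f0.
by apply: Rintegral_ge0 => t _; apply: IH => y; exact: f0.
Qed.

Lemma le_ref_simplex_int m (f g : 'rV[R]_m -> R) (s : R) : 0 <= s ->
  polyfun f -> polyfun g -> (forall y, f y <= g y) ->
  ref_simplex_int s f <= ref_simplex_int s g.
Proof.
move=> s0 pf pg fg.
have -> : g = fun y => f y + (g y + -1 * f y).
  by apply/funext => y; rewrite mulN1r addrC subrK.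
rewrite ref_simplex_intD //; last by apply: polyfunD => //; exact: polyfunZ.
by rewrite lerDl; apply: ref_simplex_int_ge0 => y; rewrite mulN1r subr_ge0.
Qed.

Lemma beta_coef_fact a e : beta_coef a e * ((a + e).+1)`!%:R = (a`! * e`!)%:R.
Proof.
elim: e a => [|e IH] a.
  by rewrite addn0 muln1 factS natrM mulrA mulVf ?mul1r // pnatr_eq0.
rewrite -[beta_coef a e.+1]/(e.+1%:R / a.+1%:R * beta_coef a.+1 e) -[LHS]mulrA.
rewrite addnS -addSn IH !factS !natrM; field.
by rewrite nat1r pnatr_eq0.
Qed.

Lemma beta_coef_gt0 a e : 0 < beta_coef a e.
Proof.
elim: e a => [|e IH] a /=; first by rewrite invr_gt0 ltr0n.
by rewrite mulr_gt0 // divr_gt0 ?ltr0n.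
Qed.

Lemma dirichlet_coef_gt0 m a : 0 < dirichlet_coef m a.
Proof. by elim: m a => [|m IH] a //=; rewrite mulr_gt0 ?beta_coef_gt0. Qed.

Lemma ref_simplex_int1 m : ref_simplex_int 1 (fun _ : 'rV[R]_m => 1) = dirichlet_coef m (fun=> 0%N).
Proof.
rewrite (_ : (fun=> _) = monomial_sum [:: (1, fun=> 0%N)]); last first.
  by apply/funext => y; rewrite /monomial_sum big_seq1 /monomial big1 ?mulr1.
by rewrite ref_simplex_int_monomial_sum // big_seq1 mul1r expr1n mulr1.
Qed.

(** Positivity comes from explicit moments: up to the factor [D], the integral is the quadratic b2 -
    2 c b1 + c^2 b in c, whose discriminant is negative because b b2 - b1^2 = 1 / ((n + 1) (n + 2)^2
    (n + 3)). *)
Lemma ref_simplex_int_coord_var m (c : R) :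
  0 < ref_simplex_int 1 (fun t : 'rV[R]_m.+1 => (t 0 0 - c) ^+ 2).
Proof.
pose a k : nat -> nat := fun i => if i is 0 then k else 0%N.
have monomialE k (y : 'rV[R]_m.+1) : monomial (a k) y = y 0 0 ^+ k.
  by rewrite /monomial big_ord_recl big1 ?mulr1.
rewrite (_ : (fun t => _) = monomial_sum [:: (1, a 2); (- (2 * c), a 1); (c ^+ 2, a 0)]); last first.
  by apply/funext => y; rewrite /monomial_sum !big_cons big_nil !monomialE /=; ring.
pose n := dirichlet_deg m (fun=> 0%N); pose D := dirichlet_coef m (fun=> 0%N).
have DE k : dirichlet_coef m.+1 (a k) = beta_coef k n * D by [].
rewrite ref_simplex_int_monomial_sum // !big_cons big_nil !expr1n.
rewrite -[dirichlet_coef _ (_, a 2).2]/(dirichlet_coef m.+1 (a 2)).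
rewrite -[dirichlet_coef _ (_, a 1).2]/(dirichlet_coef m.+1 (a 1)).
rewrite -[dirichlet_coef _ (_, a 0).2]/(dirichlet_coef m.+1 (a 0)) !DE /=.
have D0 : 0 < D by exact: dirichlet_coef_gt0.
have b0 : 0 < beta_coef 0 n by exact: beta_coef_gt0.
have f0 : 0 < n`!%:R :> R by rewrite ltr0n fact_gt0.
have fn0 : n`!%:R != 0 :> R by rewrite gt_eqF.
set b2 := beta_coef 2 n; set b1 := beta_coef 1 n; set b := beta_coef 0 n in b0 *.
pose x : R := n%:R; have x0 : 0 <= x by rewrite ler0n.
have E0 : b * (x + 1) = 1.
  apply: (mulIf fn0); transitivity ((0`! * n`!)%:R : R); last by rewrite natrM.
  by rewrite -beta_coef_fact -/b add0n factS natrM /x -natr1; ring.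
have E1 : b1 * ((x + 2) * (x + 1)) = 1.
  apply: (mulIf fn0); transitivity ((1`! * n`!)%:R : R); last by rewrite natrM.
  by rewrite -beta_coef_fact -/b1 add1n !factS !natrM /x -!natr1; ring.
have E2 : b2 * ((x + 3) * (x + 2) * (x + 1)) = 2.
  apply: (mulIf fn0); transitivity ((2`! * n`!)%:R : R); last by rewrite natrM.
  by rewrite -beta_coef_fact -/b2 add2n !factS !natrM /x -!natr1; ring.
have bE : b = (x + 1)^-1 by rewrite -[b](mulfK (_ : x + 1 != 0)) ?E0 ?mul1r //; lra.
have b1E : b1 = ((x + 2) * (x + 1))^-1.
  by rewrite -[b1](mulfK (_ : (x + 2) * (x + 1) != 0)) ?E1 ?mul1r //; nra.
have b2E : b2 = 2 / ((x + 3) * (x + 2) * (x + 1)).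
  by rewrite -[b2](mulfK (_ : (x + 3) * (x + 2) * (x + 1) != 0)) ?E2 //; nra.
have disc : 0 < b * b2 - b1 ^+ 2.
  have -> : b * b2 - b1 ^+ 2 = ((x + 1) * (x + 2) ^+ 2 * (x + 3))^-1.
    rewrite bE b1E b2E; field; rewrite !lt0r_neq0 //; nra.
  by rewrite invr_gt0 !mulr_gt0 ?exprn_gt0 //; lra.
have : 0 < D * (b * (b2 - 2 * c * b1 + c ^+ 2 * b)).
  apply: mulr_gt0 => //; have := sqr_ge0 (b * c - b1); lra.
rewrite mulrCA pmulr_rgt0 //; lra.
Qed.
End PolynomialIntegrals.

(** * Integrals over simplices in physical space *)

Section SimplexIntegrals.
Variables (R : realType) (d' : nat).
Local Notation d := d'.+1.

Lemma polyfun_affine m (p : 'I_m.+1 -> 'rV[R]_d) (f : 'rV[R]_d -> R) :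
  polyfun f -> polyfun (fun t : 'rV[R]_m => f (p ord0 + t *m edge_mx p)).
Proof.
move=> pf; apply: polyfun_comp => // j.
rewrite (_ : (fun y => _) = fun y : 'rV[R]_m => p ord0 0 j + \sum_i (edge_mx p i j) * y 0 i).
  apply: polyfunD; first exact: polyfun_cst.
  by apply: polyfun_sum => i; apply: polyfunZ; exact: polyfun_coord.
by apply/funext => y; rewrite !mxE; congr (_ + _); apply: eq_bigr => i _; rewrite mulrC.
Qed.

Lemma simplex_intD m (p : 'I_m.+1 -> 'rV[R]_d) f g : polyfun f -> polyfun g ->
  simplex_int p (fun x => f x + g x) = simplex_int p f + simplex_int p g.
Proof.
move=> pf pg; rewrite /simplex_int -mulrDr; congr (_ * _).
by apply: ref_simplex_intD => //; exact: polyfun_affine.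
Qed.

Lemma simplex_intZ m (p : 'I_m.+1 -> 'rV[R]_d) c f : polyfun f ->
  simplex_int p (fun x => c * f x) = c * simplex_int p f.
Proof.
move=> pf; rewrite /simplex_int mulrCA; congr (_ * _).
by apply: ref_simplex_intZ => //; exact: polyfun_affine.
Qed.

Lemma simplex_int_cst m (p : 'I_m.+1 -> 'rV[R]_d) c :
  simplex_int p (fun=> c) = simplex_measure p * c.
Proof.
rewrite /simplex_measure mulrC -simplex_intZ; last exact: polyfun_cst.
by congr simplex_int; apply/funext => x; rewrite mulr1.
Qed.

Lemma simplex_int_sum m (p : 'I_m.+1 -> 'rV[R]_d) (I : finType)
    (F : I -> 'rV[R]_d -> R) : (forall i, polyfun (F i)) ->
  simplex_int p (fun x => \sum_i F i x) = \sum_i simplex_int p (F i).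
Proof.
move=> h; elim: (index_enum I) => [|i r IH].
  rewrite big_nil (_ : (fun x => _) = fun=> 0) ?simplex_int_cst ?mulr0 //.
  by apply/funext => x; rewrite big_nil.
rewrite big_cons -IH -simplex_intD //; last exact: polyfun_sum.
by congr simplex_int; apply/funext => x; rewrite big_cons.
Qed.

Lemma simplex_int_ge0 m (p : 'I_m.+1 -> 'rV[R]_d) f : (forall x, 0 <= f x) ->
  0 <= simplex_int p f.
Proof.
by move=> f0; rewrite mulr_ge0 ?sqrtr_ge0 // ref_simplex_int_ge0.
Qed.

Lemma simplex_measureE m (p : 'I_m.+1 -> 'rV[R]_d) :
  simplex_measure p =
  Num.sqrt (\det (edge_mx p *m (edge_mx p)^T)) * dirichlet_coef R m (fun=> 0%N).
Proof. by rewrite /simplex_measure /simplex_int ref_simplex_int1. Qed.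

Section FullDimension.
Variable p : 'I_d.+1 -> 'rV[R]_d.
Hypothesis punit : edge_mx p \in unitmx.

Lemma sqrt_gram_gt0 : 0 < Num.sqrt (\det (edge_mx p *m (edge_mx p)^T)).
Proof.
rewrite sqrtr_gt0 det_mulmx det_tr -expr2 lt_def sqr_ge0 sqrf_eq0.
by move: punit; rewrite unitmxE unitfE => ->.
Qed.

Lemma simplex_measure_gt0 : 0 < simplex_measure p.
Proof. by rewrite simplex_measureE mulr_gt0 ?sqrt_gram_gt0 ?dirichlet_coef_gt0. Qed.

(** The vector [e] is chosen so that pairing with it recovers the first reference coordinate; by
    Cauchy-Schwarz the squared distance, times |e|^2, dominates the squared deviation of that
    coordinate. *)
Lemma simplex_int_sqdist_gt0 (c : 'rV[R]_d) :
  0 < simplex_int p (fun x => \sum_j (x 0 j - c 0 j) ^+ 2).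
Proof.
pose J := edge_mx p.
pose e : 'cV[R]_d := invmx J *m delta_mx 0 0.
pose tau := ((c - p ord0) *m e) 0 0.
pose E := \sum_j e j 0 ^+ 2.
have te (t : 'rV[R]_d) : ((p ord0 + t *m J - c) *m e) 0 0 = t 0 0 - tau.
  have -> : p ord0 + t *m J - c = t *m J - (c - p ord0).
    by rewrite opprB addrA [t *m J + _]addrC.
  have tE : t *m J *m e = col 0 t by rewrite /e -mulmxA mulKVmx // -colE.
  by rewrite mulmxBl tE mxE [X in X + _]mxE [X in _ + X]mxE.
have polf : polyfun (fun x : 'rV[R]_d => \sum_j (x 0 j - c 0 j) ^+ 2).
  apply: polyfun_sum => j; apply: polyfunX; apply: polyfunD; last exact: polyfun_cst.
  exact: polyfun_coord.
have : 0 < E * simplex_int p (fun x => \sum_j (x 0 j - c 0 j) ^+ 2).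
  rewrite -simplex_intZ //.
  apply: lt_le_trans (_ : Num.sqrt (\det (J *m J^T)) *
    ref_simplex_int 1 (fun t : 'rV[R]_d => (t 0 0 - tau) ^+ 2) <= _).
    by rewrite mulr_gt0 ?sqrt_gram_gt0 ?ref_simplex_int_coord_var.
  rewrite ler_pM2l ?sqrt_gram_gt0 //; apply: le_ref_simplex_int => //.
  - apply: polyfunX; apply: polyfunD; last exact: polyfun_cst.
    exact: polyfun_coord.
  - by apply: (polyfun_affine _ (f := fun x => E * \sum_j (x 0 j - c 0 j) ^+ 2));
      exact: polyfunZ.
  - move=> t; rewrite -te mulrC mxE.
    apply: le_trans (cauchy_schwarz_sum _ _) _; rewrite le_eqVlt; apply/orP; left.
    by apply/eqP; congr (_ * _); apply: eq_bigr => j _; rewrite !mxE.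
have E0 : 0 <= E by apply: sumr_ge0 => j _; exact: sqr_ge0.
have := E0; rewrite le_eqVlt => /predU1P[<-|Ep]; first by rewrite mul0r ltxx.
by rewrite pmulr_rgt0.
Qed.
End FullDimension.
End SimplexIntegrals.

(** * Weak gradient and discrete forms *)

Section WeakGradient.
Variables (R : realType) (d' : nat).
Local Notation d := d'.+1.

Lemma divergence_affine (c : 'rV[R]_d) (b : R) (x : 'rV[R]_d) :
  divergence (fun y => c + b *: y) x = d%:R * b.
Proof.
rewrite /divergence (eq_bigr (fun=> b)); first by rewrite sumr_const card_ord mulr_natl.
move=> i _; rewrite /derive; apply: lim_near_cst => //.
near=> h; have h0 : h != 0 by near: h; exact: nbhs_dnbhs_neq.
rewrite /= /shift /= !mxE !eqxx mulr1n mulr1 /GRing.scale /=; field.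
by [].
Unshelve. all: by end_near. Qed.

Lemma dotr_addZl n (a b c : 'rV[R]_n) (k : R) :
  dotr (a + k *: b) c = dotr a c + k * dotr b c.
Proof.
rewrite /dotr mulr_sumr -big_split; apply: eq_bigr => i _ /=.
by rewrite !mxE mulrDl mulrA.
Qed.

Lemma polyfun_dotr (c : 'rV[R]_d) : polyfun (fun x => dotr x c).
Proof.
apply: polyfun_sum => i; apply: polyfunM; first exact: polyfun_coord.
exact: polyfun_cst.
Qed.

Section Element.
Variables (T : mesh R d') (K : 'I_(nelem T)).
Hypothesis Kunit : edge_mx (elem_vert K) \in unitmx.
Variables (a : R) (b : {set 'I_(nvert T)} -> R).

Lemma vol_gt0 : 0 < vol K.
Proof. exact: simplex_measure_gt0. Qed.

(** Together with [wg_radial], the values of the right-hand side of the weak gradient equation on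
    the basis of RT0: the constant fields and the field x. *)
Definition wg_flux (j : 'I_d) : R :=
  \sum_i facet_area K i * (b (facet K i) * normal K i 0 j).

Definition wg_radial : R :=
  \sum_i b (facet K i) * simplex_int (facet_vert K i) (fun x => dotr x (normal K i))
  - vol K * (a * d%:R).

Lemma wg_rhsE (c : 'rV[R]_d) (k : R) (z := fun x : 'rV[R]_d => c + k *: x) :
  \sum_i simplex_int (facet_vert K i) (fun x => b (facet K i) * dotr (z x) (normal K i))
  - simplex_int (elem_vert K) (fun x => a * divergence z x) =
  \sum_j c 0 j * wg_flux j + k * wg_radial.
Proof.
have -> : (fun x => a * divergence z x) = fun=> a * (d%:R * k).
  by apply/funext => x; rewrite divergence_affine.
rewrite simplex_int_cst -/(vol K) /wg_radial mulrBr addrA mulr_sumr.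
congr (_ - _); last by ring.
under [X in _ = X + _]eq_bigr => j _ do rewrite /wg_flux mulr_sumr.
rewrite exchange_big -big_split; apply: eq_bigr => i _ /=.
have -> : (fun x => b (facet K i) * dotr (z x) (normal K i)) =
   fun x => b (facet K i) * dotr c (normal K i)
     + (k * b (facet K i)) * dotr x (normal K i).
  by apply/funext => x; rewrite dotr_addZl; ring.
rewrite simplex_intD; [|exact: polyfun_cst|by apply: polyfunZ; exact: polyfun_dotr].
rewrite simplex_int_cst simplex_intZ; last exact: polyfun_dotr.
rewrite -mulrA; congr (_ + _); rewrite /dotr !mulr_sumr; apply: eq_bigr => j _.
rewrite /facet_area; ring.
Qed.

(** Existence has to be shown because [weak_grad] falls back to 0 otherwise. Written around the
    centroid, RT0 is the orthogonal sum of the constants and the multiples of x - xK, so the system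
    is diagonal with pivots |K| and [Q]. *)
Lemma weak_gradP : is_weak_grad K a b (weak_grad K a b).
Proof.
rewrite /weak_grad; apply: (@xgetPex _ _ [set g | is_weak_grad K a b g]).
pose S := simplex_int (elem_vert K).
pose xK : 'rV[R]_d := \row_j (S (fun x => x 0 j) / vol K).
pose Q := S (fun x => \sum_j (x 0 j - xK 0 j) ^+ 2).
have Q0 : 0 < Q by exact: simplex_int_sqdist_gt0.
have v0 := vol_gt0.
pose g0 : 'rV[R]_d := \row_j (wg_flux j / vol K).
pose ga := (wg_radial - \sum_j xK 0 j * wg_flux j) / Q.
have pc j : polyfun (fun x : 'rV[R]_d => x 0 j - xK 0 j).
  by apply: polyfunD; [exact: polyfun_coord|exact: polyfun_cst].
exists (fun x => (g0 - ga *: xK) + ga *: x); split.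
  by exists (g0 - ga *: xK), ga.
move=> z [c [k ->]]; rewrite wg_rhsE -/S.
pose z0 := c + k *: xK.
have -> : (fun x => dotr (g0 - ga *: xK + ga *: x) (c + k *: x)) =
   fun x => dotr g0 z0 + (\sum_j (ga * z0 0 j + k * g0 0 j) * (x 0 j - xK 0 j)
     + ga * k * \sum_j (x 0 j - xK 0 j) ^+ 2).
  apply/funext => x; rewrite /dotr mulr_sumr -!big_split; apply: eq_bigr => j _ /=.
  by rewrite /z0 !mxE; ring.
rewrite /S simplex_intD; [|exact: polyfun_cst|]; last first.
  apply: polyfunD; first by apply: polyfun_sum => j; exact: polyfunZ.
  by apply: polyfunZ; apply: polyfun_sum => j; exact: polyfunX.
rewrite simplex_intD; [|by apply: polyfun_sum => j; exact: polyfunZ|]; last first.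
  by apply: polyfunZ; apply: polyfun_sum => j; exact: polyfunX.
rewrite simplex_int_cst -/(vol K) simplex_intZ; last first.
  by apply: polyfun_sum => j; exact: polyfunX.
rewrite simplex_int_sum; last by move=> j; exact: polyfunZ.
rewrite -/S -/Q.
rewrite big1 ?add0r; last first.
  move=> j _; rewrite /S simplex_intZ // simplex_intD; [|exact: polyfun_coord|exact: polyfun_cst].
  rewrite simplex_int_cst -/(vol K) -/S.
  have -> : xK 0 j = S (fun x => x 0 j) / vol K by rewrite mxE.
  by rewrite mulrN [vol K * _]mulrC divfK ?gt_eqF // subrr mulr0.
have -> : vol K * dotr g0 z0 = \sum_j c 0 j * wg_flux j + k * \sum_j xK 0 j * wg_flux j.
  rewrite /dotr !mulr_sumr -big_split; apply: eq_bigr => j _ /=.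
  by rewrite /z0 !mxE; field; rewrite gt_eqF.
by rewrite /ga; field; rewrite gt_eqF.
Qed.

(** The test field is a constant one: it is divergence free, so the interior value drops out. *)
Lemma weak_grad_mean j :
  simplex_int (elem_vert K) (fun x => weak_grad K a b x 0 j) = wg_flux j.
Proof.
have [_ wgE] := weak_gradP.
have zRT : RT0 (fun x : 'rV[R]_d => delta_mx 0 j + 0 *: x) by exists (delta_mx 0 j), 0.
have := etrans (wgE _ zRT) (wg_rhsE (delta_mx 0 j) 0).
rewrite mul0r addr0 (bigD1 j) //= mxE !eqxx mul1r big1 ?addr0; last first.
  by move=> i ij; rewrite mxE (negbTE ij) andbF mul0r.
move=> <-.
congr simplex_int; apply/funext => x; rewrite scale0r addr0 /dotr (bigD1 j) //=.
rewrite mxE !eqxx mulr1 big1 ?addr0 // => i ij.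
by rewrite mxE (negbTE ij) andbF mulr0.
Qed.

Lemma polyfun_weak_grad j : polyfun (fun x => weak_grad K a b x 0 j).
Proof.
have [[c [k ->]] _] := weak_gradP.
rewrite (_ : (fun x => _) = fun x : 'rV[R]_d => c 0 j + k * x 0 j).
  by apply: polyfunD; [exact: polyfun_cst|apply: polyfunZ; exact: polyfun_coord].
by apply/funext => x; rewrite !mxE.
Qed.
End Element.
End WeakGradient.

(** * Continuity and stability of the discrete divergence *)

Section DiscreteForms.
Variables (R : realType) (d' : nat).
Local Notation d := d'.+1.
Variables (Omega : set 'rV[R]_d) (T : mesh R d').
Hypothesis Tunit : forall K : 'I_(nelem T), edge_mx (elem_vert K) \in unitmx.
Variables (A : 'M[R]_(ndof Omega T)) (B : 'M[R]_(nelem T, ndof Omega T)).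
Hypothesis hA : stiffness_matrix A.
Hypothesis hB : divergence_matrix B.

Lemma divergence_formE (u : 'cV[R]_(ndof Omega T)) (p : 'cV[R]_(nelem T)) :
  (p^T *m B *m u) 0 0 = \sum_K vol K * weak_div u K * p K 0.
Proof.
rewrite hB; apply: eq_bigr => K _.
by rewrite simplex_int_cst -/(vol K) mulrA.
Qed.

Lemma weak_div_bound (u : 'cV[R]_(ndof Omega T)) K :
  vol K * weak_div u K ^+ 2 <= d%:R * simplex_int (elem_vert K) (fun x =>
     \sum_i \sum_j weak_grad_mx u K x i j * weak_grad_mx u K x i j).
Proof.
pose S := simplex_int (elem_vert K).
pose G i j (x : 'rV[R]_d) := weak_grad_mx u K x i j.
have pG i j : polyfun (G i j).
  rewrite (_ : G i j = fun x =>
      weak_grad K (int_val u K 0 i) (fun F => facet_val u F 0 i) x 0 j).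
    exact: polyfun_weak_grad.
  by apply/funext => x; rewrite /G mxE.
have v0 : 0 < vol K by exact: vol_gt0.
have d0 : 0 < d%:R :> R by rewrite ltr0n.
have trE : \sum_j S (G j j) = vol K * weak_div u K.
  rewrite /weak_div mulrA divff ?gt_eqF // mul1r.
  under [RHS]eq_bigr => i _ do rewrite /dotr mulr_sumr.
  rewrite exchange_big; apply: eq_bigr => j _.
  have := weak_grad_mean (Tunit K) (int_val u K 0 j) (fun F => facet_val u F 0 j) j.
  rewrite /wg_flux => <-.
  by congr simplex_int; apply/funext => x; rewrite /G mxE.
(* Each diagonal entry is compared with [c], the mean of the trace divided by d; expanding the
   integral of the sum of (G_jj - c)^2 >= 0 is Cauchy-Schwarz for the trace. *)
pose c := weak_div u K / d%:R.
have : 0 <= S (fun x => \sum_i \sum_j G i j x ^+ 2 +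
     (- (2 * c) * (\sum_j G j j x) + d%:R * c ^+ 2)).
  apply: simplex_int_ge0 => x.
  apply: (@le_trans _ _ (\sum_j (G j j x - c) ^+ 2)).
    by apply: sumr_ge0 => j _; exact: sqr_ge0.
  have -> : d%:R * c ^+ 2 = \sum_(j < d) c ^+ 2.
    by rewrite sumr_const card_ord mulr_natl.
  rewrite mulr_sumr -!big_split /=; apply: ler_sum => i _.
  have : G i i x ^+ 2 <= \sum_j G i j x ^+ 2.
    by rewrite (bigD1 i) //= lerDl sumr_ge0 // => j _; exact: sqr_ge0.
  lra.
have psq : polyfun (fun x => \sum_i \sum_j G i j x ^+ 2).
  by apply: polyfun_sum => i; apply: polyfun_sum => j; exact: polyfunX.
have ptr : polyfun (fun x => \sum_j G j j x).
  by apply: (@polyfun_sum _ _ _ _ _ (fun j => G j j)) => j; exact: pG.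
have trSE : S (fun x => \sum_j G j j x) = \sum_j S (G j j).
  by apply: (@simplex_int_sum _ _ _ _ _ (fun j => G j j)) => j; exact: pG.
rewrite /S simplex_intD //; last first.
  apply: polyfunD; last exact: polyfun_cst.
  exact: polyfunZ.
rewrite simplex_intD; [|exact: polyfunZ|exact: polyfun_cst].
rewrite simplex_int_cst simplex_intZ // -/(vol K) -/S trSE trE.
have -> : (fun x => \sum_i \sum_j weak_grad_mx u K x i j * weak_grad_mx u K x i j) =
   fun x => \sum_i \sum_j G i j x ^+ 2.
  by apply/funext => x; apply: eq_bigr => i _; apply: eq_bigr => j _; rewrite expr2.
rewrite /S; set I := simplex_int _ _ => h.
have wE : weak_div u K = c * d%:R by rewrite /c divfK // gt_eqF.
rewrite wE in h *; have := mulr_ge0 (ltW d0) h; lra.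
Qed.

Lemma divergence_form_continuous (u : 'cV[R]_(ndof Omega T)) (p : 'cV[R]_(nelem T)) :
  (p^T *m B *m u) 0 0 ^+ 2 <=
  d%:R * (p^T *m pressure_mass T *m p) 0 0 * (u^T *m A *m u) 0 0.
Proof.
have v0 (K : 'I_(nelem T)) : 0 < vol K by exact: vol_gt0.
rewrite divergence_formE diag_formE hA.
have sq (K : 'I_(nelem T)) : Num.sqrt (vol K) ^+ 2 = vol K by rewrite sqr_sqrtr // ltW.
have -> : \sum_K vol K * weak_div u K * p K 0 =
    \sum_K (Num.sqrt (vol K) * p K 0) * (Num.sqrt (vol K) * weak_div u K).
  by apply: eq_bigr => K _; rewrite -{1}sq; ring.
apply: le_trans (cauchy_schwarz_sum _ _) _.
rewrite [d%:R * _]mulrC -mulrA; apply: ler_pM.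
- by apply: sumr_ge0 => K _; exact: sqr_ge0.
- by apply: sumr_ge0 => K _; exact: sqr_ge0.
- by apply: ler_sum => K _; rewrite !mxE exprMn sq.
- by rewrite mulr_sumr; apply: ler_sum => K _; rewrite exprMn sq weak_div_bound.
Qed.

(** Since B^T q = A u, the quotient in the supremum is the energy product of u and v over the energy
    norm of v, at most the energy norm of u by Cauchy-Schwarz. *)
Lemma inf_sup_energy (beta : R) (q : 'cV[R]_(nelem T)) (u : 'cV[R]_(ndof Omega T)) :
  0 < beta -> inf_sup A B beta -> spd A -> \sum_K vol K * q K 0 = 0 ->
  B^T *m q = A *m u ->
  beta ^+ 2 * (q^T *m pressure_mass T *m q) 0 0 <= (u^T *m A *m u) 0 0.
Proof.
move=> beta0 infsup [Asym Apd] q0 BTq.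
have Am0 (v : 'cV[R]_(ndof Omega T)) : 0 <= (v^T *m A *m v) 0 0.
  have [->|v0] := eqVneq v 0; first by rewrite mulmx0 mxE.
  exact/ltW/Apd.
have M0 : 0 <= (q^T *m pressure_mass T *m q) 0 0.
  rewrite diag_formE sumr_ge0 // => K _; rewrite mulr_ge0 ?sqr_ge0 // mxE.
  by apply/ltW/vol_gt0.
have addE (X Y : 'M[R]_1) : (X + Y) 0 0 = X 0 0 + Y 0 0 by rewrite mxE.
have scaE c (X : 'M[R]_1) : (c *: X) 0 0 = c * X 0 0 by rewrite mxE.
have := infsup q; rewrite (eq_bigr (fun K => vol K * q K 0)); last first.
  by move=> K _; rewrite simplex_int_cst.
move=> /(_ q0) h.
have : beta * Num.sqrt ((q^T *m pressure_mass T *m q) 0 0) <= Num.sqrt ((u^T *m A *m u) 0 0).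
  rewrite -lee_fin; apply: le_trans h _; apply: ge_ereal_sup => _ [v /= v0 <-].
  rewrite lee_fin; have vA := Apd v v0.
  rewrite ler_pdivrMr ?sqrtr_gt0 // -sqrtrM //.
  have -> : (q^T *m B *m v) 0 0 = (u^T *m A *m v) 0 0.
    by rewrite -[q^T *m B]trmxK trmx_mul trmxK BTq trmx_mul Asym.
  apply: le_trans (ler_norm _) _; rewrite -sqrtr_sqr ler_sqrt ?mulr_ge0 ?(ltW vA) //.
  pose t := (u^T *m A *m v) 0 0 / (v^T *m A *m v) 0 0.
  have := Am0 (u - t *: v).
  have sym : (v^T *m A *m u) 0 0 = (u^T *m A *m v) 0 0.
    by rewrite trmx11 !trmx_mul trmxK Asym mulmxA.
  have -> : ((u - t *: v)^T *m A *m (u - t *: v)) 0 0 =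
     (u^T *m A *m u) 0 0 - 2 * t * (u^T *m A *m v) 0 0 + t ^+ 2 * (v^T *m A *m v) 0 0.
    rewrite -scaleNr (_ : (u + _)^T = u^T + (- t) *: v^T); last first.
      by apply/matrixP => i j; rewrite !mxE.
    rewrite !mulmxDl !mulmxDr -!scalemxAl -!scalemxAr !scalerA !addE !scaE sym; ring.
  have -> : (u^T *m A *m u) 0 0 - 2 * t * (u^T *m A *m v) 0 0 + t ^+ 2 * (v^T *m A *m v) 0 0
     = (u^T *m A *m u) 0 0 - (u^T *m A *m v) 0 0 ^+ 2 / (v^T *m A *m v) 0 0.
    by rewrite /t; field; rewrite gt_eqF.
  by rewrite subr_ge0 ler_pdivrMr.
rewrite -(@ler_pXn2r _ 2) ?nnegrE ?mulr_ge0 ?sqrtr_ge0 ?(ltW beta0) //.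
by rewrite exprMn !sqr_sqrtr.
Qed.
End DiscreteForms.

Section DiagonalSpectrum.
Variable R : realType.

Lemma eigenvalue_diag n (m : 'rV[R]_n) a :
  eigenvalue (diag_mx m) a <-> exists i, a = m 0 i.
Proof.
split=> [/eigenvalueP[v vE /rV0Pn[i vi]]|[i ->]].
  exists i; have /rowP/(_ i) := vE; rewrite mul_mx_diag !mxE mulrC.
  by move/(mulIf vi) => ->.
apply/eigenvalueP; exists (delta_mx 0 i).
  by rewrite -rowE row_diag_mx.
apply/rV0Pn; exists i; by rewrite mxE !eqxx oner_eq0.
Qed.

Lemma lambda_diag_bounds n (m : 'rV[R]_n) : (0 < n)%N -> (forall i, 0 < m 0 i) ->
  [/\ 0 < lambda_min (diag_mx m), lambda_min (diag_mx m) <= lambda_max (diag_mx m),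
      forall i, lambda_min (diag_mx m) <= m 0 i <= lambda_max (diag_mx m) &
      exists i, lambda_max (diag_mx m) = m 0 i].
Proof.
case: n m => // n m _ m0; set S := [set a | eigenvalue (diag_mx m) a].
have SP a : S a -> exists i, a = m 0 i by case: (eigenvalue_diag m a).
have memS i : S (m 0 i) by apply/eigenvalue_diag; exists i.
have [i0 i0min] : exists i0, forall i, m 0 i0 <= m 0 i.
  by case: (@arg_minP _ _ _ ord0 xpredT (fun i => m 0 i) isT) => i _ h; exists i => j; exact: h.
have [i1 i1max] : exists i1, forall i, m 0 i <= m 0 i1.
  by case: (@arg_maxP _ _ _ ord0 xpredT (fun i => m 0 i) isT) => i _ h; exists i => j; exact: h.
have lbS : has_lbound S by exists (m 0 i0); move=> _ /SP[i ->].
have ubS : has_ubound S by exists (m 0 i1); move=> _ /SP[i ->].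
have S0 : S !=set0 by exists (m 0 i0).
have lminE : lambda_min (diag_mx m) = m 0 i0.
  apply/eqP; rewrite eq_le; apply/andP; split.
    exact: (ge_inf lbS).
  by apply: (lb_le_inf S0) => _ /SP[i ->].
have lmaxE : lambda_max (diag_mx m) = m 0 i1.
  apply/eqP; rewrite eq_le; apply/andP; split.
    by apply: (ge_sup S0) => _ /SP[i ->].
  exact: (ub_le_sup ubS).
rewrite lminE lmaxE; split=> //; first by move=> i; rewrite i0min i1max.
by exists i1.
Qed.
End DiagonalSpectrum.

(** * Barycentric coordinates and facets *)

Section Barycentric.
Variables (R : realType) (d' : nat).
Local Notation d := d'.+1.

(** Rows (1, p_i): affine relations between points become linear, and barycentric coordinates of x
    are the coordinates of (1, x) in this basis. *)
Definition hom_mx m (p : 'I_m.+1 -> 'rV[R]_d) : 'M[R]_(1 + m, 1 + d) :=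
  \matrix_(i < m.+1) (row_mx 1%:M (p i) : 'rV_(1 + d)).

Definition shear_mx m : 'M[R]_(1 + m) := block_mx 1%:M 0 (const_mx 1) 1%:M.

Lemma det_shear_mx m : \det (shear_mx m) = 1.
Proof. by rewrite det_lblock !det1 mulr1. Qed.

Lemma hom_mxE m (p : 'I_m.+1 -> 'rV[R]_d) :
  hom_mx p = shear_mx m *m block_mx 1%:M (p ord0) 0 (edge_mx p).
Proof.
rewrite mulmx_block !mul1mx !mul0mx !mulmx1 !addr0.
rewrite -[block_mx _ _ _ _]/(col_mx (row_mx _ _) (row_mx _ _)).
apply/row_matrixP => i; rewrite rowK.
have [j ->|j ->] := split_ordP i.
  have -> : p (lshift m j) = p ord0 by congr p; apply/val_inj; rewrite /= ord1.
  by rewrite rowKu ord1 row_id.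
rewrite rowKd row_row_mx linearD /= rowK; congr row_mx.
  by apply/rowP => k; rewrite !mxE ord1.
have -> : row j (const_mx 1 *m p ord0) = p ord0.
  by apply/rowP => k; rewrite !mxE big_ord1 !mxE mul1r.
by rewrite addrC -[lift _ _](_ : rshift 1 j = _) ?subrK //; apply/val_inj.
Qed.

(** Conjugating the permutation matrix by the shear gives a block triangular [X]; its lower right
    block has determinant 1 or -1 and maps one edge matrix to the other. Two elements may list the
    vertices of a common facet in different orders. *)
Lemma gram_det_perm m (p : 'I_m.+1 -> 'rV[R]_d) (s : 'S_m.+1) :
  \det (edge_mx (p \o s) *m (edge_mx (p \o s))^T) =
  \det (edge_mx p *m (edge_mx p)^T).
Proof.
pose X : 'M[R]_(1 + m) := invmx (shear_mx m) *m (perm_mx s : 'M[R]_(1 + m)) *m shear_mx m.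
have Su : shear_mx m \in unitmx by rewrite unitmxE det_shear_mx unitr1.
have homE : hom_mx (p \o s) = (perm_mx s : 'M[R]_(1 + m)) *m hom_mx p.
  rewrite -row_permE; apply/row_matrixP => i.
  by rewrite row_permEsub ?rowK; apply/rowP => j; rewrite !mxE.
move: homE; rewrite !hom_mxE => /(congr1 (mulmx (invmx (shear_mx m)))).
rewrite mulKmx // !mulmxA -/X -[X]submxK mulmx_block.
rewrite !mulmx1 !mulmx0 !addr0 => /eq_block_mx[ul1 _ dl0 drE].
rewrite -dl0 mul0mx add0r in drE.
have dX : \det (drsubmx X) ^+ 2 = 1.
  have : \det X ^+ 2 = 1.
    by rewrite !det_mulmx det_inv det_shear_mx invr1 mul1r mulr1 det_perm sqrr_sign.
  by rewrite -{1}[X]submxK -dl0 det_ublock -ul1 det1 mul1r.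
set D := drsubmx X in drE dX.
have -> : edge_mx (p \o s) *m (edge_mx (p \o s))^T = D *m (edge_mx p *m (edge_mx p)^T) *m D^T.
  by rewrite drE trmx_mul !mulmxA.
by rewrite !det_mulmx det_tr mulrAC -expr2 dX mul1r.
Qed.

Section Simplex.
Variable p : 'I_d.+1 -> 'rV[R]_d.
Hypothesis punit : edge_mx p \in unitmx.

Lemma hom_mx_unit : hom_mx p \in unitmx.
Proof.
rewrite hom_mxE unitmx_mul !unitmxE det_shear_mx unitr1 det_ublock det1 mul1r.
by rewrite -unitmxE.
Qed.

Definition bary (x : 'rV[R]_d) (i : 'I_d.+1) : R :=
  ((row_mx 1%:M x : 'rV_(1 + d)) *m invmx (hom_mx p)) 0 i.

Lemma mul_hom_mx (l : 'I_d.+1 -> R) :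
  (\row_(j < d.+1) l j) *m hom_mx p =
  row_mx (\sum_i l i)%:M (\sum_i l i *: p i) :> 'rV_(1 + d).
Proof.
apply/rowP => k; rewrite mxE.
have E i : (\row_(j < d.+1) l j) 0 i * hom_mx p i k =
    l i * (row_mx 1%:M (p i) : 'rV_(1 + d)) 0 k.
  by rewrite !mxE.
under eq_bigr do rewrite E.
have [j ->|j ->] := split_ordP k.
  rewrite row_mxEl ord1 mxE mulr1n; apply: eq_bigr => i _.
  by rewrite row_mxEl mxE mulr1.
by rewrite row_mxEr summxE; apply: eq_bigr => i _; rewrite row_mxEr mxE.
Qed.

Lemma bary_unique (l : 'I_d.+1 -> R) x :
  \sum_i l i = 1 -> x = \sum_i l i *: p i -> forall i, bary x i = l i.
Proof.
move=> l1 xE i; rewrite /bary xE -l1 -mul_hom_mx mulmxK ?hom_mx_unit //.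
by rewrite mxE.
Qed.

Lemma bary_sum x : \sum_i bary x i = 1 /\ x = \sum_i bary x i *: p i.
Proof.
have : (\row_i bary x i) *m hom_mx p = (row_mx 1%:M x : 'rV_(1 + d)).
  rewrite -[RHS](mulmxKV hom_mx_unit); congr (_ *m _).
  by apply/rowP => i; rewrite mxE.
rewrite mul_hom_mx => /eq_row_mx[/matrixP/(_ 0 0)]; rewrite !mxE => s1 s2.
by split.
Qed.

Lemma bary_vert k i : bary (p k) i = (k == i)%:R.
Proof.
apply: (@bary_unique (fun i => (k == i)%:R)).
  by rewrite (bigD1 k) //= eqxx big1 ?addr0 // => j; rewrite eq_sym => /negbTE ->.
rewrite (bigD1 k) //= eqxx scale1r big1 ?addr0 // => j.
by rewrite eq_sym => /negbTE ->; rewrite scale0r.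
Qed.

Definition bary_grad (i : 'I_d.+1) : 'rV[R]_d :=
  \row_j (invmx (hom_mx p) : 'M[R]_(1 + d)) (rshift 1 j) i.

Lemma baryB x y i : bary x i - bary y i = dotr (x - y) (bary_grad i).
Proof.
rewrite /bary !mxE -sumrB big_split_ord /= big_ord1 !row_mxEl subrr add0r.
by apply: eq_bigr => j _; rewrite !row_mxEr !mxE mulrBl.
Qed.

Lemma bary_line x y t i :
  bary (x + t *: (y - x)) i = bary x i + t * (bary y i - bary x i).
Proof.
rewrite -[LHS](subrK (bary x i)) !baryB addrC [x + _]addrC addrK.
congr (_ + _).
by rewrite -[t *: _]add0r dotr_addZl /dotr big1 ?add0r // => j _; rewrite mxE mul0r.
Qed.

End Simplex.
End Barycentric.

(** * Normals and areas of a facet seen from its elements *)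

Section FacetGeometry.
Variables (R : realType) (d' : nat).
Local Notation d := d'.+1.
Variable T : mesh R d'.
Hypothesis Tunit : forall K : 'I_(nelem T), edge_mx (elem_vert K) \in unitmx.
Local Notation bar K := (bary (elem_vert K)).
Implicit Types (K L M : 'I_(nelem T)) (i j k l : 'I_d.+1).

Lemma elem_inj K : injective (elem K).
Proof.
move=> i j ij; have : bar K (elem_vert K i) i = bar K (elem_vert K j) i.
  by rewrite /elem_vert ij.
by rewrite !bary_vert // eqxx; case: eqP => // _ /eqP; rewrite oner_eq0.
Qed.

Lemma mem_facet K k i : (elem K k \in facet K i) = (k != i).
Proof.
apply/imsetP/idP => [[j _ /elem_inj ->]|ki]; first by rewrite eq_sym neq_lift.
have [h ->] : exists h, k = lift i h.
  by move: ki; rewrite eq_sym => /unlift_some[h -> _]; exists h.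
by exists h.
Qed.

Lemma facetE K i : facet K i = elem_vset K :\ elem K i.
Proof.
apply/setP => v; rewrite 2!inE; apply/idP/andP => [vF|[vi /imsetP[k _ vk]]].
  have /imsetP[j _ vj] := vF; split; last by rewrite vj; exact: imset_f.
  by rewrite vj (inj_eq (@elem_inj K)) eq_sym neq_lift.
by move: vi; rewrite vk (inj_eq (@elem_inj K)) mem_facet.
Qed.

(** Uniqueness of barycentric coordinates replaces the existential over all mesh vertices by
    conditions relative to one element; conformity of the mesh is exploited in this form. *)
Lemma vhullP K (S : {set 'I_(nvert T)}) x : S \subset elem_vset K ->
  vhull S x <-> (forall i, 0 <= bar K x i) /\
                (forall i, elem K i \notin S -> bar K x i = 0).
Proof.
move=> SK; split=> [[l [l0 lS l1 xE]]|[b0 bS]].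
  have sumE (V : zmodType) (f : 'I_(nvert T) -> V) :
      (forall v, v \notin S -> f v = 0) -> \sum_v f v = \sum_i f (elem K i).
    move=> fS; rewrite (bigID (mem (elem_vset K))) /= addrC big1 ?add0r; last first.
      by move=> v vK; apply: fS; apply: contra vK => /(fintype.subsetP SK).
    by rewrite big_imset //= => i j _ _; exact: elem_inj.
  have bE : forall i, bar K x i = l (elem K i).
    apply: bary_unique => //; first by rewrite -sumE.
    by rewrite xE sumE // => v vS; rewrite lS // scale0r.
  by split=> i; rewrite bE //; exact: lS.
have [b1 xE] := bary_sum (Tunit K) x.
exists (fun v => \sum_(i | elem K i == v) bar K x i); split.
- by move=> v; apply: sumr_ge0 => i _; exact: b0.
- by move=> v vS; apply: big1 => i /eqP iv; apply: bS; rewrite iv.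
- by rewrite -b1 (partition_big (elem K) xpredT).
- rewrite [LHS]xE (partition_big (elem K) xpredT) //=; apply: eq_bigr => v _.
  by rewrite scaler_suml; apply: eq_bigr => i /eqP <-.
Qed.

Lemma bary_vertex_facet K L i j k : facet K i = facet L j -> k != i ->
  bar L (elem_vert K k) j = 0.
Proof.
move=> FE ki; have : elem K k \in facet L j by rewrite -FE mem_facet.
case/imsetP => h _ kh; have -> : elem_vert K k = elem_vert L (lift j h).
  by rewrite /elem_vert kh.
by rewrite bary_vert // eq_sym (negbTE (neq_lift _ _)).
Qed.

Lemma bary_comp K L j x :
  bar L x j = \sum_k bar K x k * bar L (elem_vert K k) j.
Proof.
have [b1 xE] := bary_sum (Tunit K) x.
apply: (bary_unique (Tunit L) (l := fun j => \sum_k bar K x k * bar L (elem_vert K k) j)).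
  rewrite exchange_big -[RHS]b1; apply: eq_bigr => k _.
  by rewrite -mulr_sumr (bary_sum (Tunit L) _).1 mulr1.
rewrite {1}xE.
under [RHS]eq_bigr do rewrite scaler_suml.
rewrite exchange_big; apply: eq_bigr => k _ /=.
under [RHS]eq_bigr do rewrite -scalerA.
by rewrite -scaler_sumr -(bary_sum (Tunit L) _).2.
Qed.

(** Two affine functions vanishing on the same facet are proportional. The sign of the factor tells
    whether the two elements lie on the same side. *)
Lemma bary_facet_scale K L i j x : facet K i = facet L j ->
  bar L x j = bar L (elem_vert K i) j * bar K x i.
Proof.
move=> FE; rewrite (bary_comp K) (bigD1 i) //= big1 ?addr0 1?mulrC // => k ki.
by rewrite (bary_vertex_facet FE ki) mulr0.
Qed.

Lemma dotr_self_ge0 n (x : 'rV[R]_n) : 0 <= dotr x x.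
Proof. by apply: sumr_ge0 => i _; rewrite -expr2 sqr_ge0. Qed.

Lemma enorm_scale n (c : R) (x : 'rV[R]_n) : enorm (c *: x) = `|c| * enorm x.
Proof.
rewrite /enorm -sqrtr_sqr -sqrtrM ?sqr_ge0 //; congr Num.sqrt.
by rewrite /dotr mulr_sumr; apply: eq_bigr => i _; rewrite !mxE; ring.
Qed.

Lemma dotrZl n (c : R) (x y : 'rV[R]_n) : dotr (c *: x) y = c * dotr x y.
Proof. by rewrite /dotr mulr_sumr; apply: eq_bigr => i _; rewrite mxE mulrA. Qed.

Lemma dotrC n (x y : 'rV[R]_n) : dotr x y = dotr y x.
Proof. by apply: eq_bigr => i _; rewrite mulrC. Qed.

Lemma dotr_delta n (x : 'rV[R]_n) e : dotr (delta_mx 0 e) x = x 0 e.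
Proof.
rewrite /dotr (bigD1 e) //= mxE !eqxx mul1r big1 ?addr0 // => i ij.
by rewrite mxE (negbTE ij) andbF mul0r.
Qed.

Lemma facet_vert_bary K i h : bar K (facet_vert K i h) i = 0.
Proof. by rewrite bary_vert // eq_sym (negbTE (neq_lift _ _)). Qed.

Lemma bary_grad_norm_gt0 K i : 0 < enorm (bary_grad (elem_vert K) i).
Proof.
rewrite sqrtr_gt0 lt_def dotr_self_ge0 andbT; apply/eqP => g0.
have gE e : bary_grad (elem_vert K) i 0 e = 0.
  move/eqP: g0; rewrite psumr_eq0 => [/allP/(_ e (mem_index_enum _))|k _].
    by rewrite /= -expr2 sqrf_eq0 => /eqP.
  by rewrite -expr2 sqr_ge0.
have := baryB (elem_vert K) (elem_vert K i) (facet_vert K i 0) i.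
rewrite facet_vert_bary bary_vert // eqxx subr0 /dotr big1 => [/eqP|j _].
  by rewrite oner_eq0.
by rewrite gE mulr0.
Qed.

Lemma outward_normal_unique K i n : is_outward_normal K i n ->
  n = (- (enorm (bary_grad (elem_vert K) i))^-1) *: bary_grad (elem_vert K) i.
Proof.
move=> [n1 nF nout]; set g := bary_grad _ _.
pose v0 := facet_vert K i 0.
pose s := dotr n (elem_vert K i - v0).
have s0 : s < 0 by exact: nout.
have dotB (x y z : 'rV[R]_d) : dotr x (y - z) = dotr x y - dotr x z.
  by rewrite /dotr -sumrB; apply: eq_bigr => j _; rewrite !mxE mulrBr.
have vE k : dotr n (elem_vert K k) = dotr n v0 + (k == i)%:R * s.
  have [->|ki] := eqVneq k i; first by rewrite mul1r /s dotB addrC subrK.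
  have [h ->] : exists h, k = lift i h.
    by move: ki; rewrite eq_sym => /unlift_some[h -> _]; exists h.
  by have := nF h 0; rewrite dotB mul0r addr0 => /eqP; rewrite subr_eq0 => /eqP.
have nE x : dotr n x = dotr n v0 + s * bar K x i.
  have [b1 xE] := bary_sum (Tunit K) x.
  have -> : dotr n x = \sum_k bar K x k * dotr n (elem_vert K k).
    rewrite {1}xE /dotr.
    under eq_bigr do rewrite summxE mulr_sumr.
    rewrite exchange_big; apply: eq_bigr => k _ /=; rewrite mulr_sumr.
    by apply: eq_bigr => j _; rewrite mxE; ring.
  under eq_bigr do rewrite vE mulrDr.
  rewrite big_split -mulr_suml b1 mul1r; congr (_ + _).
  rewrite (bigD1 i) //= eqxx mul1r big1 ?addr0 1?mulrC // => k /negbTE ->.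
  by rewrite mul0r mulr0.
have ng : n = s *: g.
  apply/rowP => j; rewrite -dotr_delta dotrC mxE -[delta_mx 0 j]subr0 dotB.
  rewrite (nE (delta_mx 0 j)) (nE 0).
  rewrite opprD addrACA subrr add0r -mulrBr baryB subr0.
  by rewrite dotr_delta.
have := n1; rewrite ng enorm_scale ltr0_norm // => h.
congr (_ *: _); apply/eqP; rewrite -eqr_oppLR; apply/eqP.
by rewrite -[LHS](mulfK (lt0r_neq0 (bary_grad_norm_gt0 K i))) h mul1r.
Qed.

(** The negative normalized gradient of the barycentric coordinate is an outward normal, so the
    choice in [normal] is not the default 0; uniqueness identifies it. *)
Lemma normalE K i : normal K i =
  (- (enorm (bary_grad (elem_vert K) i))^-1) *: bary_grad (elem_vert K) i.
Proof.
apply: outward_normal_unique; rewrite /normal.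
apply: (@xgetPex _ 0 [set n | is_outward_normal K i n]).
pose g := bary_grad (elem_vert K) i; have g0 : 0 < enorm g by exact: bary_grad_norm_gt0.
exists (- (enorm g)^-1 *: g); split.
- by rewrite enorm_scale normrN gtr0_norm ?invr_gt0 // mulVf // gt_eqF.
- by move=> h k; rewrite dotrZl dotrC -baryB !facet_vert_bary subrr mulr0.
- move=> h; rewrite dotrZl dotrC -baryB facet_vert_bary bary_vert // eqxx subr0 mulr1.
  by rewrite oppr_lt0 invr_gt0.
Qed.

Lemma side_neq0 K L i j : facet K i = facet L j -> bar L (elem_vert K i) j != 0.
Proof.
move=> FE; apply/eqP => c0; have := bary_facet_scale (elem_vert L j) FE.
by rewrite c0 mul0r bary_vert // eqxx => /eqP; rewrite oner_eq0.
Qed.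

Lemma bary_grad_scale K L i j : facet K i = facet L j ->
  bary_grad (elem_vert L) j = bar L (elem_vert K i) j *: bary_grad (elem_vert K) i.
Proof.
move=> FE; apply/rowP => e; rewrite -dotr_delta mxE -[X in _ * X]dotr_delta.
rewrite -[delta_mx 0 e]subr0 -!baryB.
rewrite (bary_facet_scale (delta_mx 0 e) FE) (bary_facet_scale 0 FE); ring.
Qed.

Lemma normal_opposite K L i j : facet K i = facet L j ->
  bar L (elem_vert K i) j < 0 -> normal L j = - normal K i.
Proof.
move=> FE c0; rewrite !normalE (bary_grad_scale FE) enorm_scale ltr0_norm //.
rewrite scalerA -scaleNr opprK; congr (_ *: _).
have := bary_grad_norm_gt0 K i => g0; field.
by rewrite gt_eqF // lt_eqF.
Qed.

Lemma facet_area_eq K L i j : facet K i = facet L j -> facet_area L j = facet_area K i.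
Proof.
move=> FE.
have /choice[f fE] : forall h, exists h', elem L (lift j h) = elem K (lift i h').
  move=> h; have : elem L (lift j h) \in facet K i.
    by rewrite FE mem_facet eq_sym neq_lift.
  by case/imsetP => h' _ ->; exists h'.
have finj : injective f.
  move=> h h' hh; apply: (@lift_inj _ j); apply: (@elem_inj L).
  by rewrite !fE hh.
have vE : facet_vert L j = facet_vert K i \o perm finj.
  by apply/funext => h; rewrite /facet_vert /elem_vert /= permE fE.
by rewrite /facet_area !simplex_measureE vE gram_det_perm.
Qed.

End FacetGeometry.

(** * The two elements at an interior facet *)

Section InteriorFacets.
Variables (R : realType) (d' : nat).
Local Notation d := d'.+1.
Variables (Omega : set 'rV[R]_d) (T : mesh R d').
Hypothesis triT : triangulates Omega T.
Local Notation bar K := (bary (elem_vert K)).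
Implicit Types (K L M : 'I_(nelem T)) (i j k l : 'I_d.+1).

Let Tunit K : edge_mx (elem_vert K) \in unitmx.
Proof. by case: triT. Qed.

Definition facet_center K i : 'rV[R]_d := \sum_(k | k != i) d%:R^-1 *: elem_vert K k.

Lemma bary_facet_center K i k : bar K (facet_center K i) k = (k != i)%:R / d%:R.
Proof.
apply: (bary_unique (Tunit K) (l := fun k => (k != i)%:R / d%:R)).
  rewrite -mulr_suml (bigD1 i) //= eqxx add0r (eq_bigr (fun=> 1)); last first.
    by move=> j ->.
  by rewrite sumr_const cardC1 card_ord divff // pnatr_eq0.
rewrite /facet_center [RHS](bigD1 i) //= eqxx mul0r scale0r add0r.
by apply: eq_bigr => j ->; rewrite mul1r.
Qed.

Lemma bary_facet_center_ge K L i j l : facet K i = facet L j -> l != j ->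
  d%:R^-1 <= bar L (facet_center K i) l.
Proof.
move=> FE lj.
have -> : facet_center K i = facet_center L j.
  rewrite /facet_center.
  have E M k : \sum_(l | l != k) d%:R^-1 *: elem_vert M l =
      \sum_(v in facet M k) d%:R^-1 *: vert v.
    have -> : facet M k = [set elem M l | l in [pred l | l != k]]%SET.
      apply/setP => v; apply/idP/imsetP => [/imsetP[h _ ->]|[h hk ->]].
        by exists (lift k h); rewrite // inE eq_sym neq_lift.
      by rewrite mem_facet.
    by rewrite big_imset //= => ? ? _ _; exact: elem_inj.
  by rewrite !E FE.
by rewrite bary_facet_center lj mul1r.
Qed.

Lemma facet_sub K i : facet K i \subset elem_vset K.
Proof. by rewrite facetE // subD1set. Qed.

Lemma card_elem_vset K : #|elem_vset K| = d.+1.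
Proof. by rewrite card_imset ?card_ord //; exact: elem_inj. Qed.

(** A common point of the two elements off the facet lies, by conformity, in the hull of their
    common vertices. Its coordinate at the vertex opposite the facet is positive, so that vertex is
    shared as well and the vertex sets agree. *)
Lemma same_side_eq K L i j : facet K i = facet L j ->
  0 < bar L (elem_vert K i) j -> K = L /\ i = j.
Proof.
have [_ _ vset_inj _ cap] := triT.
move=> FE c0.
have d0 : 0 < d%:R^-1 :> R by rewrite invr_gt0 ltr0n.
pose M := \sum_l `|bar L (elem_vert K i) l|.
have M0 : 0 <= M by apply: sumr_ge0.
(* Solves (1 - e) / d = e M: coordinates that are at least 1 / d at the center and at least -M at
   the vertex stay nonnegative. *)
pose e := d%:R^-1 / (d%:R^-1 + M).
have e0 : 0 < e by rewrite divr_gt0 // ltr_wpDr.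
have eE : e * (d%:R^-1 + M) = d%:R^-1 by rewrite divfK // gt_eqF // ltr_wpDr.
have e1 : e <= 1 by rewrite ler_pdivrMr ?ltr_wpDr // mul1r lerDl.
(* A point of [K] this close to the center of the facet also lies in [L]. *)
pose x := facet_center K i + e *: (elem_vert K i - facet_center K i).
have xL : elem_hull L x.
  apply/(vhullP Tunit) => //; split; last by move=> k; rewrite imset_f.
  move=> l; rewrite bary_line //.
  have [->|lj] := eqVneq l j.
    have -> : bar L (facet_center K i) j = 0.
      by rewrite (bary_facet_scale Tunit _ FE) bary_facet_center eqxx mul0r mulr0.
    by rewrite add0r subr0 mulr_ge0 // ltW.
  have h1 := bary_facet_center_ge FE lj.
  have h2 : - M <= bar L (elem_vert K i) l.
    have : `|bar L (elem_vert K i) l| <= M.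
      by rewrite /M (bigD1 l) //= lerDl sumr_ge0.
    by rewrite ler_norml => /andP[].
  have p1 : 0 <= (1 - e) * (bar L (facet_center K i) l - d%:R^-1).
    by rewrite mulr_ge0 // subr_ge0.
  have p2 : 0 <= e * (bar L (elem_vert K i) l + M).
    by rewrite mulr_ge0 ?(ltW e0) // -lerBlDr sub0r.
  move: eE p1 p2; set a := bar L _ l; set b := bar L _ l; set r := d%:R^-1.
  by rewrite !(mulrDr, mulrDl, mulrN, mulNr, mul1r, mulr1, mulrBr, mulrBl); lra.
have xK : elem_hull K x.
  apply/(vhullP Tunit) => //; split; last by move=> k; rewrite imset_f.
  move=> k; rewrite bary_line // bary_facet_center bary_vert //.
  have [_|_] := eqVneq k i; rewrite /= ?mul0r ?mul1r ?add0r ?subr0 ?sub0r ?mulr1 ?(ltW e0) //.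
  by rewrite mulrN -{1}[d%:R^-1]mul1r -mulrBl mulr_ge0 ?(ltW d0) // subr_ge0.
have : (elem_hull K `&` elem_hull L) x by [].
rewrite cap => /(vhullP Tunit (K := K)) -/(_ (subsetIl _ _)) [_ xS].
have iL : elem K i \in elem_vset L.
  apply: contraT => iL; have : bar K x i = 0 by apply: xS; rewrite inE (negbTE iL) andbF.
  rewrite bary_line // bary_facet_center bary_vert // !eqxx mul0r add0r subr0 mulr1.
  by move=> e00; rewrite e00 ltxx in e0.
have KL : elem_vset K = elem_vset L.
  apply/eqP; rewrite eqEcard !card_elem_vset leqnn andbT.
  apply/fintype.subsetP => v vK; have [->//|vi] := eqVneq v (elem K i).
  have : v \in facet K i by rewrite facetE // !inE vi.
  by rewrite FE; apply/fintype.subsetP/facet_sub.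
have {}KL := vset_inj _ _ KL; subst L; split=> //.
apply/eqP; apply: contraT => ij; have : elem K i \in facet K i.
  by rewrite FE mem_facet.
by rewrite mem_facet // eqxx.
Qed.



Lemma vhull_sub (S S' : {set 'I_(nvert T)}) : S \subset S' -> vhull S `<=` vhull S'.
Proof.
move=> SS x [l [l0 lS l1 xE]]; exists l; split=> // v vS'; apply: lS.
by apply: contra vS'; exact: (fintype.subsetP SS).
Qed.

Lemma ge0_of_arbitrarily_small (f0 f1 : R) :
  (forall e, 0 < e -> exists2 t, 0 < t <= e & 0 <= f0 + t * f1) -> 0 <= f0.
Proof.
move=> h; rewrite leNgt; apply/negP => f00.
have n0 : 0 <= `|f1| by [].
pose e := - f0 / (`|f1| + 1).
have e0 : 0 < e by rewrite divr_gt0 ?oppr_gt0 // ltr_wpDl.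
have eE : e * (`|f1| + 1) = - f0 by rewrite divfK // gt_eqF // ltr_wpDl.
have [t /andP[t0 te] ht] := h e e0.
have f1n : f1 <= `|f1| by exact: ler_norm.
nra.
Qed.

(** Near a point of Omega on the facet, points just outside K are still covered by elements. The
    given point may sit on the relative boundary of the facet, hence the small move towards the
    center. *)
Lemma opposite_side_exists K i : interior_facet Omega (facet K i) ->
  exists L j, facet K i = facet L j /\ bar L (elem_vert K i) j < 0.
Proof.
have [_ _ _ cover cap] := triT.
move=> /andP[_ /asboolPn /existsNP[x /not_implyP[xF xb]]].
have xK : elem_hull K x by apply: vhull_sub xF; exact: facet_sub.
have xO : nbhs x Omega.
  have : closure Omega x by rewrite cover; exists K.
  by move=> xc; have [//|ni] := pselect (interior Omega x); case: xb.
have [_ xFb] := (vhullP Tunit x (facet_sub K i)).1 xF.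
have [xK0 _] := (vhullP Tunit x (subxx _)).1 xK.
have xi0 : bar K x i = 0 by apply: xFb; rewrite mem_facet // eqxx.
have [dl dl0 ballO] : exists2 dl : R, 0 < dl & forall y, `|x - y| < dl -> Omega y.
  by have /nbhs_ballP[dl dl0 hb] := xO; exists dl => // y xy; apply: hb; rewrite -ball_normE.
pose x0 := facet_center K i.
have small (v : 'rV[R]_d) :
    exists2 e : R, 0 < e <= 1 & forall t, 0 <= t <= e -> `|t *: v| < dl / 2.
  have n0 : 0 <= `|v| by [].
  pose D := 2 * `|v| + dl; have D0 : 0 < D by rewrite /D; lra.
  have DD : 0 < D + D by rewrite addr_gt0.
  exists (dl / (D + D)).
    apply/andP; split; first by rewrite divr_gt0.
    by rewrite ler_pdivrMr // mul1r /D; lra.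
  move=> t /andP[t0]; rewrite ler_pdivlMr // => te.
  rewrite normrZ ger0_norm // ltr_pdivlMr //.
  have := mulr_ge0 t0 n0; have := mulr_ge0 t0 (ltW dl0); rewrite /D in te; nra.
(* [x1] is a point of Omega in the relative interior of the facet; [y t] leaves
   [K] through it. *)
have [eta /andP[eta0 eta1] etaE] := small (x0 - x).
pose x1 := x + eta *: (x0 - x).
have [e1 /andP[e10 _] e1E] := small (elem_vert K i - x1).
pose y t := x1 + (- t) *: (elem_vert K i - x1).
have yO t : 0 < t <= e1 -> exists L, elem_hull L (y t).
  move=> /andP[t0 te]; have : closure Omega (y t).
    apply: subset_closure; apply: ballO.
    have -> : x - y t = t *: (elem_vert K i - x1) - eta *: (x0 - x).
      by rewrite /y scaleNr {1}/x1 !opprD opprK !addrA subrr add0r addrC.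
    apply: le_lt_trans (ler_normB _ _) _.
    rewrite [ltRHS](splitr dl); apply: ltrD; first by rewrite e1E // (ltW t0).
    by rewrite etaE // ltW //=.
  by rewrite cover => -[L _ yL]; exists L.
(* Finitely many elements: if each missed all sufficiently small t, the minimum of the thresholds
   would give an uncovered point. *)
have [L yL] : exists L, forall e, 0 < e -> exists2 t, 0 < t <= e & elem_hull L (y t).
  apply: contrapT => /forallNP nL.
  have /choice[f fP] : forall L, exists e, 0 < e /\ forall t, 0 < t <= e -> ~ elem_hull L (y t).
    move=> L; have /existsNP[e /not_implyP[e0 he]] := nL L.
    by exists e; split=> // t te yt; apply: he; exists t.
  pose e := \big[Num.min/e1]_L f L.
  have e0 : 0 < e.
    rewrite /e; elim/big_ind: _ => // [a b a0 b0|M _]; first by rewrite lt_min a0.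
    by case: (fP M).
  have ee1 : 0 < e <= e1 by rewrite e0 /e bigmin_le_id.
  have [M yM] := yO e ee1.
  by case: (fP M) => _ /(_ e); apply=> //; rewrite e0 /e bigmin_le_cond.
have yb M l t : bar M (y t) l = bar M x1 l + (- t) * (bar M (elem_vert K i) l - bar M x1 l).
  exact: bary_line.
have x1L : elem_hull L x1.
  apply/(vhullP Tunit) => //; split; last by move=> k; rewrite imset_f.
  move=> l; apply: (@ge0_of_arbitrarily_small _ (- (bar L (elem_vert K i) l - bar L x1 l))).
  move=> e e0; have [t te yt] := yL e e0; exists t => //.
  have [y0 _] := (vhullP Tunit _ (subxx _)).1 yt.
  by have := y0 l; rewrite yb mulNr mulrN.
have x1b k : bar K x1 k = bar K x k + eta * (bar K x0 k - bar K x k) by exact: bary_line.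
have d0 : 0 < d%:R^-1 :> R by rewrite invr_gt0 ltr0n.
have x1i : bar K x1 i = 0.
  by rewrite x1b xi0 bary_facet_center eqxx mul0r subr0 mulr0 addr0.
have x1pos k : k != i -> 0 < bar K x1 k.
  move=> ki; have bx0 : bar K x0 k = d%:R^-1 by rewrite bary_facet_center ki mul1r.
  have p1 : 0 <= (1 - eta) * bar K x k by rewrite mulr_ge0 // subr_ge0.
  have p2 : 0 < eta * d%:R^-1 by rewrite mulr_gt0.
  by rewrite x1b bx0; move: p1 p2; set b := bar K x k; set r := d%:R^-1; nra.
have x1K : elem_hull K x1.
  apply/(vhullP Tunit) => //; split; last by move=> k; rewrite imset_f.
  by move=> k; have [->|ki] := eqVneq k i; [rewrite x1i|exact/ltW/x1pos].
have : (elem_hull K `&` elem_hull L) x1 by [].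
rewrite cap => /(vhullP Tunit (K := K)) -/(_ (subsetIl _ _)) [_ xS].
have FL : facet K i \subset elem_vset L.
  apply/fintype.subsetP => _ /imsetP[h _ ->]; apply: contraT => hL.
  have : bar K x1 (lift i h) = 0 by apply: xS; rewrite inE (negbTE hL) andbF.
  by move=> h0; have := x1pos (lift i h); rewrite eq_sym neq_lift h0 ltxx => /(_ isT).
have cardF M k : #|facet M k| = d.
  have := cardsD1 (elem M k) (elem_vset M).
  by rewrite imset_f // card_elem_vset add1n -facetE // => -[].
have [j jF] : exists j, elem L j \notin facet K i.
  apply: contrapT => /forallNP nj.
  have : elem_vset L \subset facet K i.
    by apply/fintype.subsetP => _ /imsetP[j _ ->]; apply: contraT => /nj.
  by move/subset_leq_card; rewrite cardF card_elem_vset ltnn.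
have FE : facet K i = facet L j.
  apply/eqP; rewrite eqEcard !cardF leqnn andbT; apply/fintype.subsetP => v vF.
  rewrite facetE // !inE (fintype.subsetP FL) // andbT.
  by apply: contraNneq jF => <-.
exists L, j; split=> //; rewrite lt_neqAle (side_neq0 Tunit FE) /=.
have [t /andP[t0 _] yt] := yL 1 ltr01.
have [y0 _] := (vhullP Tunit _ (subxx _)).1 yt.
(* The coordinate of [y t] in L is the side factor times -t; being nonnegative, it makes that factor
   nonpositive. *)
have := y0 j; rewrite (bary_facet_scale Tunit _ FE) yb x1i add0r subr0 bary_vert // eqxx mulr1.
by rewrite mulrN oppr_ge0 pmulr_lle0.
Qed.

Lemma interior_facet_flux (F : {set 'I_(nvert T)}) : interior_facet Omega F ->
  \sum_(Ki : 'I_(nelem T) * 'I_d.+1 | facet Ki.1 Ki.2 == F)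
     facet_area Ki.1 Ki.2 *: normal Ki.1 Ki.2 = 0.
Proof.
move=> Fint; have /andP[/existsP[K /existsP[i /eqP FE]] _] := Fint.
have [L [j [KL c0]]] : exists L j, facet K i = facet L j /\ bar L (elem_vert K i) j < 0.
  by apply: opposite_side_exists; rewrite -FE.
rewrite (bigD1 (K, i)) ?FE //= (bigD1 (L, j)) /=; last first.
  rewrite -KL eqxx /=; apply/eqP => -[LK ji]; move: c0; rewrite LK ji.
  by rewrite bary_vert // eqxx ltr10.
rewrite big1 => [|[M l] /= /andP[/andP[/eqP ME MK] ML]]; last first.
  exfalso; have KM : facet K i = facet M l by rewrite ME.
  have [cM|cM] := ltP 0 (bar M (elem_vert K i) l).
    by have [KM' il] := same_side_eq KM cM; rewrite KM' il eqxx in MK.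
  (* A third element M opposite to K would be on the same side as L, since the side factors
     multiply, and so would equal L. *)
  have LM : facet L j = facet M l by rewrite -KL.
  have : 0 < bar M (elem_vert L j) l.
    rewrite (bary_facet_scale Tunit _ KM).
    have := bary_facet_scale Tunit (elem_vert L j) KL.
    rewrite bary_vert // eqxx => h1.
    have cM0 : bar M (elem_vert K i) l < 0 by rewrite lt_neqAle side_neq0.
    by rewrite nmulr_rgt0 // -(nmulr_rgt0 _ c0) -h1.
  by move=> cLM; have [LM' jl] := same_side_eq LM cLM; rewrite LM' jl eqxx in ML.
by rewrite addr0 (normal_opposite Tunit KL c0) (facet_area_eq Tunit KL) scalerN subrr.
Qed.

(** A discrete divergence theorem: regrouped by facets, interior fluxes cancel in pairs, and on the
    other facets [insub] fails, so the facet value is 0. *)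
Lemma sum_facet_flux (u : 'cV[R]_(ndof Omega T)) :
  \sum_K \sum_i facet_area K i * dotr (facet_val u (facet K i)) (normal K i) = 0.
Proof.
rewrite pair_big /= (partition_big (fun Ki => facet Ki.1 Ki.2) xpredT) //=.
apply: big1 => F _.
have [Fint|Fext] := boolP (interior_facet Omega F); last first.
  apply: big1 => -[K i] /= /eqP ->; rewrite /dotr big1 ?mulr0 // => e _.
  by rewrite mxE insubN // mul0r.
transitivity (dotr (facet_val u F)
    (\sum_(Ki : 'I_(nelem T) * 'I_d.+1 | facet Ki.1 Ki.2 == F)
     facet_area Ki.1 Ki.2 *: normal Ki.1 Ki.2)).
  rewrite /dotr; under [RHS]eq_bigr do rewrite summxE mulr_sumr.
  rewrite [RHS]exchange_big; apply: eq_bigr => -[K i] /= /eqP ->.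
  have scaleE (a : R) (n : 'rV[R]_d) e : (a *: n) 0 e = a * n 0 e by rewrite mxE.
  by rewrite mulr_sumr; apply: eq_bigr => e _; rewrite scaleE mulrCA.
by rewrite interior_facet_flux // /dotr big1 // => e _; rewrite [X in _ * X]mxE mulr0.
Qed.

Lemma divergence_form_ones (B : 'M[R]_(nelem T, ndof Omega T)) c :
  divergence_matrix B -> B^T *m (const_mx c : 'cV_(nelem T)) = 0.
Proof.
move=> hB; apply/colP => e; rewrite mxE [RHS]mxE.
have := divergence_formE hB (delta_mx e 0) (const_mx c).
rewrite -colE.
set u : 'cV[R]_(ndof Omega T) := delta_mx e 0.
have -> : \sum_K vol K * weak_div u K * (const_mx c : 'cV_(nelem T)) K 0 = 0.
  rewrite (eq_bigr (fun K =>
    c * \sum_i facet_area K i * dotr (facet_val u (facet K i)) (normal K i))).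
    by rewrite -mulr_sumr sum_facet_flux mulr0.
  by move=> K _; rewrite mxE /weak_div mulrA divff ?mul1r 1?mulrC // gt_eqF // vol_gt0.
rewrite !mxE => h; rewrite -[RHS]h; apply: eq_bigr => K _; rewrite !mxE mulrC //.
Qed.

End InteriorFacets.

(** * Volume bound and conclusion *)

Section VolumeBound.
Variables (R : realType) (d' : nat).
Local Notation d := d'.+1.

Lemma norm_det_le n (M : 'M[R]_n) (c : R) : (forall i j, `|M i j| <= c) ->
  `|\det M| <= #|{: 'S_n}|%:R * c ^+ n.
Proof.
move=> h; rewrite /determinant; apply: le_trans (ler_norm_sum _ _ _) _.
apply: (@le_trans _ _ (\sum_(s : 'S_n) c ^+ n)); last first.
  by rewrite sumr_const mulr_natl.
apply: ler_sum => s _; rewrite normrM normr_sign mul1r normr_prod.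
rewrite -[n in c ^+ n]card_ord -prodr_const; apply: ler_prod => i _.
by rewrite normr_ge0 h.
Qed.

Variable T : mesh R d'.
Implicit Type K : 'I_(nelem T).

Lemma vhull_coord_le (S : {set 'I_(nvert T)}) x e : vhull S x ->
  `|x 0 e| <= \sum_v \sum_k `|vert (m := T) v 0 k|.
Proof.
move=> [l [l0 _ l1 ->]]; rewrite summxE.
apply: le_trans (ler_norm_sum _ _ _) _; apply: ler_sum => v _.
have lv1 : l v <= 1 by rewrite -l1 (bigD1 v) //= lerDl sumr_ge0.
rewrite mxE normrM ger0_norm //; apply: (@le_trans _ _ `|vert v 0 e|).
  by rewrite ler_piMl.
by rewrite (bigD1 e) //= lerDl sumr_ge0.
Qed.

Lemma vertex_in_hull K i : elem_hull K (elem_vert K i).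
Proof.
exists (fun v => (v == elem K i)%:R); split.
- by move=> v; rewrite ler0n.
- by move=> v vK; case: eqP vK => // ->; rewrite imset_f.
- by rewrite (bigD1 (elem K i)) //= eqxx big1 ?addr0 // => v /negbTE ->.
- rewrite (bigD1 (elem K i)) //= eqxx scale1r big1 ?addr0 // => v /negbTE ->.
  by rewrite scale0r.
Qed.

Lemma edge_length_le K i j : enorm (elem_vert K i - elem_vert K j) <= mesh_size T.
Proof.
apply: (@le_trans _ _ (elem_diam K)); last first.
  by rewrite /mesh_size; exact: (le_bigmax _ (fun K => elem_diam K)).
apply: ub_le_sup; last first.
  by exists (elem_vert K i), (elem_vert K j); split=> //; exact: vertex_in_hull.
(* A crude bound is enough: it only makes the set under [sup] bounded, without which the supremum
   would say nothing. *)
pose C := \sum_v \sum_k `|vert (m := T) v 0 k|.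
exists (Num.sqrt (\sum_(e < d) (C + C) ^+ 2)) => _ [x [y [xK yK ->]]].
rewrite ler_wsqrtr //; apply: ler_sum => e _; rewrite -expr2.
rewrite -[_ ^+ 2]real_normK ?num_real // ler_sqr ?nnegrE //; last first.
  by rewrite addr_ge0 // sumr_ge0 // => v _; rewrite sumr_ge0.
rewrite !mxE; apply: le_trans (ler_normB _ _) _.
by apply: lerD; [exact: (vhull_coord_le _ xK)|exact: (vhull_coord_le _ yK)].
Qed.

Lemma vol_le K : mesh_size T <= 1 ->
  vol K <= Num.sqrt #|{: 'S_d}|%:R * dirichlet_coef R d (fun=> 0%N) * mesh_size T.
Proof.
set h := mesh_size T => h1.
have h0 : 0 <= h by apply: le_trans (edge_length_le K 0 0); rewrite sqrtr_ge0.
rewrite /vol simplex_measureE mulrAC; apply: ler_wpM2r; first exact/ltW/dirichlet_coef_gt0.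
rewrite -[h in leRHS]ger0_norm // -sqrtr_sqr -sqrtrM ?ler0n // ler_wsqrtr //.
set J := edge_mx _.
have JJ i : \sum_k J i k ^+ 2 <= h ^+ 2.
  have := edge_length_le K (lift ord0 i) ord0; rewrite -/h /enorm => hs.
  have : dotr (elem_vert K (lift ord0 i) - elem_vert K ord0)
    (elem_vert K (lift ord0 i) - elem_vert K ord0) <= h ^+ 2.
    rewrite -[leLHS]sqr_sqrtr ?dotr_self_ge0 // ler_sqr ?nnegrE ?sqrtr_ge0 //.
  apply: le_trans; rewrite /dotr le_eqVlt; apply/orP; left; apply/eqP.
  by apply: eq_bigr => k _; rewrite mxE expr2.
apply: le_trans (ler_norm _) _.
apply: le_trans (norm_det_le (c := h ^+ 2) _) _.
  move=> i j; rewrite mxE -(@ler_pXn2r _ 2) ?nnegrE ?sqr_ge0 // real_normK ?num_real //.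
  apply: (@le_trans _ _ ((\sum_k J i k ^+ 2) * \sum_k J j k ^+ 2)).
    under eq_bigr do rewrite [X in _ * X]mxE.
    exact: cauchy_schwarz_sum.
  by rewrite expr2; apply: ler_pM => //; apply: sumr_ge0 => k _; exact: sqr_ge0.
(* For h <= 1, h^(2 d) is weakened to h^2; a volume bound linear in h already tends to 0. *)
by rewrite ler_wpM2l ?ler0n // -exprM; apply: ler_wiXn2l; rewrite // leq_pmulr.
Qed.
End VolumeBound.

Lemma vol_small (R : realType) (d' : nat) (e : R) : 0 < e ->
  exists2 h0 : R, 0 < h0 & forall (T : mesh R d') (K : 'I_(nelem T)),
    mesh_size T <= h0 -> vol K <= e.
Proof.
move=> e0; pose c := Num.sqrt #|{: 'S_d'.+1}|%:R * dirichlet_coef R d'.+1 (fun=> 0%N).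
have c0 : 0 < c.
  rewrite mulr_gt0 ?dirichlet_coef_gt0 // sqrtr_gt0 ltr0n.
  by apply/card_gt0P; exists 1%g.
exists (Num.min 1 (e / c)); first by rewrite lt_min ltr01 divr_gt0.
move=> T K; rewrite le_min => /andP[h1 he].
apply: le_trans (vol_le K h1) _; rewrite -/c mulrC -ler_pdivlMr //.
Qed.

Theorem proposition4p1 (R : realType) (d' : nat)
  (hd : d'.+1 = 2%N \/ d'.+1 = 3%N)
  (Omega : set 'rV[R]_d'.+1) (hOmega : polyhedral_lipschitz_domain Omega)
  (F : set (mesh R d'))
  (hF : forall T, F T -> triangulates Omega T) (hqu : quasi_uniform F)
  (A : forall T : mesh R d', 'M[R]_(ndof Omega T))
  (hA : forall T, F T -> stiffness_matrix (A T))
  (B : forall T : mesh R d', 'M[R]_(nelem T, ndof Omega T))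
  (hB : forall T, F T -> divergence_matrix (B T))
  (beta : R) (hbeta : 0 < beta < 1)
  (hinfsup : forall T, F T -> inf_sup (A T) (B T) beta)
  (gamma rho : R) (hgamma : gamma != 0) (hrho : 0 < rho) :
  exists C h0 : R, 0 < h0 /\
  forall T, F T -> mesh_size T <= h0 ->
  forall w : 'cV[R]_(nelem T),
    (w^T *m w) 0 0 = 1 -> (w^T *m unit_ones) 0 0 = gamma ->
  let d : R := d'.+1%:R in
  let s : R := Num.sqrt d * (1 + Num.sqrt (1 + 4 * d)) in
  let C1 : R := beta ^+ 2 *
    (lambda_min (pressure_mass T) / lambda_max (pressure_mass T)) *
    gamma ^+ 2 in
  exists E : R, `|E| <= C * mesh_size T ^+ d'.+1 /\
  forall H : 'M[R]_(ndof Omega T + nelem T),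
    is_invsqrt (block_precond (A T) rho w) H ->
  forall r0 : 'cV[R]_(ndof Omega T + nelem T), r0 != 0 ->
  forall (k : nat) (r : 'cV[R]_(ndof Omega T + nelem T)),
    minres_residual (H *m stokes_matrix (A T) (B T) rho w *m H) r0 (2 * k) r ->
    cnorm r / cnorm r0 <= 2 * ((s - 2 * C1) / (s + 2 * C1) + E) ^+ k.
Proof.
have g2 : 0 < gamma ^+ 2 by rewrite lt_def sqr_ge0 sqrf_eq0 hgamma.
have [h0 h00 volh] : exists2 h0 : R, 0 < h0 &
    forall (T : mesh R d') (K : 'I_(nelem T)),
      mesh_size T <= h0 -> vol K <= rho * gamma ^+ 2 / 6.
  by apply: vol_small; rewrite divr_gt0 // mulr_gt0.
exists 0, h0; split=> // T FT hT w ww wg d s C1.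
exists 0; split; first by rewrite normr0 mul0r.
move=> H HP r0 r00 k r hr; rewrite addr0.
have triT := hF T FT; have [_ Tunit _ _ _] := triT.
(* A unit vector [w] excludes the empty mesh. *)
have N0 : (0 < nelem T)%N.
  rewrite lt0n; apply/eqP => N0; move: ww; rewrite mxE big1 => [|i _].
    by move/eqP; rewrite eq_sym oner_eq0.
  by have := ltn_ord i; rewrite [X in (_ < X)%N]N0.
have NR : 0 < (nelem T)%:R :> R by rewrite ltr0n.
have v0 (K : 'I_(nelem T)) : 0 < vol K by exact: vol_gt0.
pose m : 'rV[R]_(nelem T) := \row_K vol K.
have [l0 lL mlL [K LE]] : [/\ 0 < lambda_min (diag_mx m),
    lambda_min (diag_mx m) <= lambda_max (diag_mx m),
    forall i, lambda_min (diag_mx m) <= m 0 i <= lambda_max (diag_mx m) &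
    exists i, lambda_max (diag_mx m) = m 0 i].
  by apply: lambda_diag_bounds => // K; rewrite mxE.
have Lrho : lambda_max (diag_mx m) <= rho * gamma ^+ 2 / 6.
  by rewrite LE mxE; exact: volh.
apply: (@stokes_minres_rate _ _ _ (A T) (B T) m w unit_ones d rho beta gamma
  (lambda_min (diag_mx m)) (lambda_max (diag_mx m)) s C1 H r0 r k) => //.
- under eq_bigr do rewrite mxE.
  rewrite sumr_const card_ord exprVn sqr_sqrtr ?(ltW NR) // -[LHS]mulr_natl divff //.
  by rewrite gt_eqF.
- by rewrite -ww mxE; apply: eq_bigr => i _; rewrite [X in _ = X * _]mxE expr2.
- by rewrite -wg mxE; apply: eq_bigr => i _; rewrite [X in _ = X * _]mxE.
- under eq_bigr do rewrite !mxE.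
  rewrite -mulr_suml gt_eqF // mulr_gt0 ?invr_gt0 ?sqrtr_gt0 //.
  rewrite (bigD1 K) //= ltr_wpDr // sumr_ge0 // => L _; exact: ltW.
- by rewrite /d ler_nat; case: hd => ->.
- by move=> u p; exact: (divergence_form_continuous Tunit (hA T FT) (hB T FT)).
- move=> Aspd q u q0 BTq; case/andP: hbeta => beta0 _.
  apply: (inf_sup_energy Tunit beta0 (hinfsup T FT) Aspd _ BTq).
  by rewrite -[RHS]q0; apply: eq_bigr => L _; rewrite mxE.
- exact: (divergence_form_ones triT _ (hB T FT)).
Qed.
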